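(* Let $\alpha$ and $\gamma$ be two (complex) algebraic numbers and suppose that $|\alpha|>1$ and $\mathrm{Re}(\gamma)>0$. Let $$T(x)=\#\{(n,m)\in\mathbb{N}^2 : |\alpha^n-(e^{\gamma})^m|\leq x\}.$$ Then $$T(x)=\frac{(\log x)^2}{(\log|\alpha|)\cdot\mathrm{Re}(\gamma)}+O(\log x\cdot\log\log x)$$ for $x$ large enough, and the implied constants are effectively computable.
   Context: $\mathbb{N}$ denotes the positive integers. The $O$-constant refers to $x\to\infty$ and may depend on $\alpha,\gamma$. *)

(* Defs.v *)
From HB Require Import structures.
From mathcomp Require Import all_boot all_order all_algebra finmap.
From mathcomp Require Import all_classical all_reals all_analysis.
From mathcomp Require Import complex.

Set Implicit Arguments.
Unset Strict Implicit.
Unset Printing Implicit Defensive.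

Import Order.TTheory GRing.Theory Num.Theory.
Import numFieldNormedType.Exports.
Import ComplexField.Normc.

Local Open Scope classical_set_scope.
Local Open Scope ring_scope.

Fixpoint prim_rec k (f : k.-tuple nat -> nat) (g : k.+2.-tuple nat -> nat)
    (n : nat) (t : k.-tuple nat) : nat :=
  if n is n'.+1 then g [tuple of n' :: prim_rec f g n' t :: t] else f t.

(* The total recursive functions of Kleene: the least class containing the
   basic functions and closed under composition, primitive recursion and
   minimisation of regular functions. In [rec_mu], the last two premises say that
   [h t] is the least zero of [f (_, t)]. *)
Inductive recursive : forall k, (k.-tuple nat -> nat) -> Prop :=
| rec_zero k : recursive (fun _ : k.-tuple nat => 0%N)
| rec_succ : recursive (fun t : 1.-tuple nat => (thead t).+1)
| rec_proj k (i : 'I_k) : recursive (fun t : k.-tuple nat => tnth t i)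
| rec_comp k l (f : l.-tuple nat -> nat) (g : 'I_l -> k.-tuple nat -> nat) :
    recursive f -> (forall i, recursive (g i)) ->
    recursive (fun t : k.-tuple nat => f [tuple g i t | i < l])
| rec_prim k (f : k.-tuple nat -> nat) (g : k.+2.-tuple nat -> nat) :
    recursive f -> recursive g ->
    recursive (fun t : k.+1.-tuple nat =>
                 prim_rec f g (thead t) [tuple of behead t])
| rec_mu k (f : k.+1.-tuple nat -> nat) (h : k.-tuple nat -> nat) :
    recursive f ->
    (forall t, f [tuple of h t :: t] = 0%N) ->
    (forall t n, (n < h t)%N -> f [tuple of n :: t] <> 0%N) ->
    recursive h.

(* A finite description of an algebraic number: [(p, a, b, r)] describes the
   only complex root of [p] in the open disc of centre [a + i b] and radius
   [r]. *)
Definition alg_descr : Type := ({poly int} * rat * rat * rat)%type.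

(* The coding of descriptions by natural numbers is the concrete, computable one
   that MathComp derives from the codings of pairs, sequences and integers. It
   is qualified because finmap shadows [pickle]. *)
Definition alg_code (d : alg_descr) : nat := choice.pickle d.

Section Complex.
Variable R : realType.
Implicit Types (z alpha gamma : R[i]) (x : R).

Definition describes (d : alg_descr) z : Prop :=
  let: (p, a, b, r) := d in
  let D := [set w : R[i] | normc (w - Complex (ratr a) (ratr b)) < ratr r] in
  let Z := [set w : R[i] | root (map_poly intr p) w] in
  p != 0 /\ D `&` Z = [set z].

Definition expC z : R[i] :=
  Complex (expR (complex.Re z) * cos (complex.Im z))
          (expR (complex.Re z) * sin (complex.Im z)).

Definition close_pairs alpha gamma x : set (nat * nat) :=
  [set nm | [/\ (0 < nm.1)%N, (0 < nm.2)%N &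
     normc (alpha ^+ nm.1 - expC gamma ^+ nm.2) <= x]].

(* [fset_set] is [fset0] on infinite sets, so this is meaningful only
   together with the finiteness of [close_pairs]. *)
Definition close_count alpha gamma x : nat :=
  #|` fset_set (close_pairs alpha gamma x)|%fset.

End Complex.

(* Main.v *)
Require Import Defs.
From HB Require Import structures.
From mathcomp Require Import all_boot all_order all_algebra finmap.
From mathcomp Require Import all_classical all_reals all_analysis.
From mathcomp Require Import complex.
From mathcomp Require Import zify ring lra.

Set Implicit Arguments.
Unset Strict Implicit.
Unset Printing Implicit Defensive.

Import Order.TTheory GRing.Theory Num.Theory.
Import numFieldNormedType.Exports.
Import ComplexField.Normc.

Local Open Scope classical_set_scope.
Local Open Scope ring_scope.

(* Only moduli matter: with l = ln |alpha| and g = Re gamma,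
   |alpha^n - e^(gamma m)| >= |e^(n l) - e^(m g)|, and e^(2l) = alpha * conj alpha,
   2g = gamma + conj gamma are algebraic. The key estimate is the gap
   |e^(n l) - e^(m g)| > e^(n l / 2) for n >= n0, with n0 explicit.
   Given it, a pair outside the box n l, m g <= ln x + 1 satisfies
   |n l - m g| <= 1 and n l <= 2 ln x unless n < n0, so there are O(log x)
   of those, while all pairs with n l, m g <= ln x - 1 are counted.

   For the gap, suppose it fails and put beta = 2 m g / n, an algebraic number of
   controlled height extremely close to 2l. Type I Hermite-Pade forms
   F(z) = sum_k P_k(z) e^(k z), k <= K, with deg P_k < rho and vanishing at 0 to order
   s = (K+1) rho - 1, are built by solving y' = k y + f, y(0) = 0 repeatedly. This
   gives integral control on the coefficients and z^s/s! <= F(z) <= z^s/s! e^(K z)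
   for z >= 0. By positivity Z = sum_k P_k(beta) e^(2 l k), which is very close to
   F(beta), is nonzero, so no zero estimate is needed. Liouville's
   inequality bounds Z from below; for K fixed and rho about sqrt n this contradicts the
   upper bound.

   Liouville's inequality is obtained by realising numbers as eigenvalues of integer
   matrices with a common eigenvector; everything depends on the defining polynomials
   only through a bound on their sizes and coefficients, and the codes of the
   descriptions provide it. *)

(** * Recursive functions *)

Lemma eq_recursive k (f g : k.-tuple nat -> nat) :
  f =1 g -> recursive f -> recursive g.
Proof. by move=> /funext ->. Qed.

Lemma recursive_const k c : recursive (fun _ : k.-tuple nat => c).
Proof.
elim: c => [|c IHc]; first exact: rec_zero.
by apply: eq_recursive (rec_comp rec_succ (fun=> IHc)) => t; rewrite /thead tnth_mktuple.
Qed.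

Lemma recursive_comp2 k (F : nat -> nat -> nat) (f g : k.-tuple nat -> nat) :
  recursive (fun t : 2.-tuple nat => F (thead t) (tnth t 1)) ->
  recursive f -> recursive g -> recursive (fun t => F (f t) (g t)).
Proof.
move=> recF recf recg.
pose h (i : 'I_2) := if i == 0 then f else g.
have rech i : recursive (h i) by rewrite /h; case: ifP.
by apply: eq_recursive (rec_comp recF rech) => t; rewrite /thead !tnth_mktuple.
Qed.

(** Primitive recursion in the shape needed below: sum, product and power arise by iterating
    successor, addition and multiplication with a fixed parameter. *)
Lemma recursive_iter (g : nat -> nat -> nat) (u : nat -> nat) :
  recursive (fun t : 1.-tuple nat => u (thead t)) ->
  recursive (fun t : 2.-tuple nat => g (thead t) (tnth t 1)) ->
  recursive (fun t : 2.-tuple nat =>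
    iter (thead t) (g (tnth t 1)) (u (tnth t 1))).
Proof.
move=> recu recg.
pose h (t : 3.-tuple nat) := g (tnth t 2%:R) (tnth t 1).
have rech : recursive h by apply: recursive_comp2 recg _ _; apply: rec_proj.
apply: eq_recursive (rec_prim recu rech) => t.
have E : thead (behead_tuple t) = tnth t 1.
  by rewrite [RHS](tnth_nth 0%N) /thead (tnth_nth 0%N) /= nth_behead.
elim: (thead t) => [|n IHn]; first by rewrite /= -E.
by rewrite iterS -IHn /= /h !(tnth_nth 0%N) /= nth_behead.
Qed.

Lemma recursive_add k (f g : k.-tuple nat -> nat) :
  recursive f -> recursive g -> recursive (fun t => f t + g t)%N.
Proof.
apply: recursive_comp2.
have recS : recursive (fun t : 2.-tuple nat => (tnth t 1).+1).
  apply: eq_recursive (rec_comp rec_succ (fun=> rec_proj 1)) => t.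
  by rewrite /thead !tnth_mktuple.
have rec_id : recursive (fun t : 1.-tuple nat => thead t) by apply: rec_proj.
apply: eq_recursive (recursive_iter (g := fun=> S) rec_id recS) => t.
by elim: (thead t) => //= n ->.
Qed.

Lemma recursive_mul k (f g : k.-tuple nat -> nat) :
  recursive f -> recursive g -> recursive (fun t => f t * g t)%N.
Proof.
apply: recursive_comp2.
have recD : recursive (fun t : 2.-tuple nat => addn (thead t) (tnth t 1)).
  by apply: recursive_add; apply: rec_proj.
have rec0 : recursive (fun _ : 1.-tuple nat => 0%N) by apply: recursive_const.
apply: eq_recursive (recursive_iter (g := addn) (u := fun=> 0%N) rec0 recD) => t.
by elim: (thead t) => //= n ->; rewrite mulSn.
Qed.

Lemma recursive_exp k (f g : k.-tuple nat -> nat) :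
  recursive f -> recursive g -> recursive (fun t => f t ^ g t)%N.
Proof.
move=> recf recg; apply: (recursive_comp2 (F := fun m n => n ^ m)%N) recg recf.
have recM : recursive (fun t : 2.-tuple nat => muln (thead t) (tnth t 1)).
  by apply: recursive_mul; apply: rec_proj.
have rec1 : recursive (fun _ : 1.-tuple nat => 1%N) by apply: recursive_const.
apply: eq_recursive (recursive_iter (g := muln) (u := fun=> 1%N) rec1 recM) => t.
by elim: (thead t) => //= n ->; rewrite expnS.
Qed.

(** * Codes bound coefficients *)

(** The code of a sequence exceeds each of its entries. An integer is coded as a pair of optional
    naturals, one slot per sign, so each layer only increases the code. *)
Lemma pickle_int_ge (z : int) : (`|z| <= choice.pickle z)%N.
Proof.
have pickle_some (n : nat) : (n < choice.pickle (Some n))%N.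
  by have /= := CodeSeq.ltn_code [:: n]; rewrite andbT.
have pickle_pair (T1 T2 : countType) (u : T1 * T2) :
   (choice.pickle u.1 < choice.pickle u)%N /\ (choice.pickle u.2 < choice.pickle u)%N.
  case: u => u v; have /= := CodeSeq.ltn_code [:: choice.pickle u; choice.pickle v].
  by case/and3P.
case: z => n.
  have [h _] := pickle_pair _ _ (Some n, None : option nat).
  exact: leq_trans (ltnW (pickle_some n)) (ltnW h).
have [_ h] := pickle_pair _ _ (None : option nat, Some n).
exact: ltn_trans (pickle_some n) h.
Qed.
Definition int_poly_norm (p : {poly int}) : nat := (\sum_(i < size p) absz (p`_i)%R)%N.

(** The code of a sequence bounds its length as well as its entries, hence the square: at most [N]
    coefficients, each at most [N]. *)
Lemma alg_code_poly (d : alg_descr) :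
  (size d.1.1.1 <= alg_code d)%N /\ (int_poly_norm d.1.1.1 <= alg_code d ^ 2)%N.
Proof.
have pickle_pair (T1 T2 : countType) (u : T1) (v : T2) :
   (choice.pickle u < choice.pickle (u, v))%N.
  have /= := CodeSeq.ltn_code [:: choice.pickle u; choice.pickle v].
  by case/and3P.
case: d => [[[p a] b] r] /=.
set N := alg_code _.
have lepN : (choice.pickle p < N)%N.
  exact: ltn_trans (ltn_trans (pickle_pair _ _ _ _) (pickle_pair _ _ _ _)) (pickle_pair _ _ _ _).
have ep : choice.pickle p = CodeSeq.code (map choice.pickle (polyseq p)) by [].
have size_code (s : seq nat) : (size s <= CodeSeq.code s)%N.
  elim: s => //= i s IHs; have : (0 < 2 ^ i)%N by rewrite expn_gt0.
  by move: IHs; rewrite -muln2; nia.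
have leszN : (size p <= N)%N.
  apply: leq_trans (ltnW lepN); rewrite ep.
  by apply: leq_trans (size_code _); rewrite size_map.
split=> //; rewrite /int_poly_norm.
apply: (@leq_trans (\sum_(i < size p) N)%N); last first.
  by rewrite sum_nat_const card_ord -mulnn leq_mul2r leszN orbT.
apply: leq_sum => i _; apply: leq_trans (pickle_int_ge _) _.
apply: leq_trans (ltnW lepN); rewrite ep ltnW //.
have /allP := CodeSeq.ltn_code (map choice.pickle (polyseq p)).
by apply; apply: map_f; rewrite mem_nth.
Qed.

(** * Eigenvalues of integer matrices *)

Section IntOp.
Variable C : numClosedFieldType.

(** The eigenvector [v] is kept fixed so that sums and products of eigenvalues come from sums and
    products of matrices. The absolute row sums form a submultiplicative norm, so [B] acts as a
    height. *)
Definition int_op (I : finType) (v : I -> C) (B : nat) (x : C) : Prop :=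
  exists M : I -> I -> int,
    (forall i, x * v i = \sum_j (M i j)%:~R * v j) /\
    (forall i, \sum_j absz (M i j) <= B)%N.

Section Closure.
Variables (I : finType) (v : I -> C).

Lemma int_op_le B B' x : (B <= B')%N -> int_op v B x -> int_op v B' x.
Proof.
by move=> leB [M [Mv MB]]; exists M; split=> // i; apply: leq_trans (MB i) leB.
Qed.

Lemma int_op_int (z : int) : int_op v (absz z) z%:~R.
Proof.
exists (fun i j => if j == i then z else 0); split=> i.
  by rewrite (bigD1 i) //= eqxx big1 ?addr0 // => j /negbTE ->; rewrite mul0r.
by rewrite (bigD1 i) //= eqxx big1 ?addn0 // => j /negbTE ->.
Qed.

Lemma int_op_nat (n : nat) : int_op v n n%:R.
Proof. by have := int_op_int n; rewrite absz_nat pmulrn. Qed.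

Lemma int_opD B B' x y : int_op v B x -> int_op v B' y -> int_op v (B + B') (x + y).
Proof.
move=> [M [Mv MB]] [M' [Mv' MB']]; exists (fun i j => M i j + M' i j); split=> i.
  rewrite mulrDl Mv Mv' -big_split /=; apply: eq_bigr => j _.
  by rewrite intrD mulrDl.
apply: leq_trans (leq_add (MB i) (MB' i)); rewrite -big_split /=.
by apply: leq_sum => j _; lia.
Qed.

Lemma int_op_sum n (B : 'I_n -> nat) (x : 'I_n -> C) :
  (forall i, int_op v (B i) (x i)) -> int_op v (\sum_i B i) (\sum_i x i).
Proof.
move=> Bx; elim/big_ind2: _ => //; first exact: (int_op_nat 0).
by move=> ? ? ? ?; apply: int_opD.
Qed.

Lemma int_opM B B' x y : int_op v B x -> int_op v B' y -> int_op v (B * B') (x * y).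
Proof.
move=> [M [Mv MB]] [M' [Mv' MB']].
exists (fun i k => \sum_j M i j * M' j k); split=> i.
  rewrite mulrAC Mv mulr_suml.
  under eq_bigr => j _ do rewrite -mulrA [v j * y]mulrC Mv' mulr_sumr.
  rewrite exchange_big; apply: eq_bigr => k _ /=.
  rewrite rmorph_sum mulr_suml; apply: eq_bigr => j _ /=.
  by rewrite rmorphM /= mulrA.
apply: (@leq_trans (\sum_k \sum_j absz (M i j) * absz (M' j k))%N).
  apply: leq_sum => k _; elim/big_ind2: _ => //.
    by move=> a b c d ha hb; lia.
  by move=> j _; rewrite abszM.
rewrite exchange_big /=; apply: (@leq_trans (\sum_j absz (M i j) * B')%N).
  by apply: leq_sum => j _; rewrite -big_distrr /= leq_mul2l MB' orbT.
by rewrite -big_distrl /= leq_mul2r MB orbT.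
Qed.

Lemma int_opX B x n : int_op v B x -> int_op v (B ^ n) (x ^+ n).
Proof.
move=> Bx; elim: n => [|n IHn]; first exact: (int_op_nat 1).
by rewrite expnS exprS; apply: int_opM.
Qed.

Hypothesis v_neq0 : exists i, v i != 0.

(* Compare both sides of the eigenvector equation at an entry of maximal modulus. *)
Lemma int_op_norm B x : int_op v B x -> `|x| <= B%:R.
Proof.
move=> [M [Mv MB]]; have [i0 vi0] := v_neq0.
have realv i : `|v i| \is Num.real by rewrite normr_real.
have [i _ ismax] := real_arg_maxP (isT : predT i0) (fun i _ => realv i).
have vi_gt0 : 0 < `|v i| by apply: lt_le_trans (ismax i0 isT); rewrite normr_gt0.
rewrite -(ler_pM2r vi_gt0) -normrM Mv.
apply: le_trans (ler_norm_sum _ _ _) _.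
apply: (@le_trans _ _ (\sum_j (absz (M i j))%:R * `|v i|)).
  by apply: ler_sum => j _; rewrite normrM natr_absz intr_norm ler_wpM2l //; apply: ismax.
by rewrite -mulr_suml -natr_sum ler_wpM2r // ler_nat.
Qed.

End Closure.

(* The nonzero eigenvalues of the matrix multiply to a coefficient of its
   integral characteristic polynomial. *)
Lemma int_op_liouville (I : finType) (v : I -> C) B x :
  (exists i, v i != 0) -> int_op v B x -> x != 0 -> 1 <= `|x| * B%:R ^+ #|I|.
Proof.
move=> v_neq0 Bx x0; have B_ge : 1 <= B%:R :> C.
  have := int_op_norm v_neq0 Bx; case: B {Bx} => [|B]; last by rewrite (ler_nat _ 1).
  by rewrite mulr0n normr_le0 (negbTE x0).
move: Bx => [M [Mv MB]].
have sumE (F : I -> C) : \sum_i F i = \sum_(i < #|I|) F (enum_val i).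
  by rewrite -big_enum_val.
(* Transposed, since eigenvectors are row vectors here. *)
pose A : 'M[int]_#|I| := \matrix_(i, j) M (enum_val j) (enum_val i).
pose AC : 'M[C]_#|I| := map_mx intr A.
(* Every eigenvalue, with an eigenvector of its own, obeys the same bound as [x]. *)
have root_norm z : root (char_poly AC) z -> `|z| <= B%:R.
  rewrite -eigenvalue_root_char => /eigenvalueP [u uA u0].
  pose w i := u 0 (enum_rank i).
  have w0 : exists i, w i != 0.
    move/rV0Pn: u0 => [j uj]; exists (enum_val j).
    by rewrite /w enum_valK.
  have : @int_op I w B z; last exact: int_op_norm.
  exists M; split=> // i.
  have /rowP/(_ (enum_rank i)) := uA; rewrite !mxE sumE => <-.
  by apply: eq_bigr => j _; rewrite !mxE enum_rankK mulrC /w enum_valK.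
have x_root : root (char_poly AC) x.
  rewrite -eigenvalue_root_char; apply/eigenvalueP.
  exists (\row_i v (enum_val i)).
    apply/rowP => j; rewrite !mxE Mv sumE; apply: eq_bigr => i _.
    by rewrite !mxE mulrC.
  have [i vi] := v_neq0; apply/rV0Pn; exists (enum_rank i).
  by rewrite mxE enum_rankK.
have charZ : char_poly AC = map_poly intr (char_poly A) by rewrite map_char_poly.
have [rs] := closed_field_poly_normal (char_poly AC).
rewrite (monicP (char_poly_monic AC)) scale1r => prs.
have size_rs : size rs = #|I|.
  by have := size_prod_XsubC rs id; rewrite -prs size_char_poly => -[].
pose nz := [seq z <- rs | z != 0]; pose q := \prod_(z <- nz) ('X - z%:P).
have pE : char_poly AC = 'X^(count (pred1 0) rs) * q.
  rewrite prs /q big_filter (bigID (fun z => z == 0)) /=; congr (_ * _).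
  rewrite (eq_bigr (fun=> 'X)); last by move=> z /eqP ->; rewrite subr0.
  by rewrite big_const_seq iter_mulr_1; congr ('X^_); apply: eq_count.
have q0 : q`_0 = \prod_(z <- nz) (- z).
  rewrite -horner_coef0 horner_prod; apply: eq_bigr => z _.
  by rewrite hornerXsubC sub0r.
have coefE : q`_0 = ((char_poly A)`_(count (pred1 0) rs))%:~R.
  by rewrite -coef_map -charZ pE coefXnM ltnn subnn.
have prod_ge1 : 1 <= \prod_(z <- nz) `|z|.
  have -> : \prod_(z <- nz) `|z| = `|q`_0|.
    by rewrite q0 normr_prod; apply: eq_bigr => z _; rewrite normrN.
  have : q`_0 != 0.
    rewrite q0 prodf_seq_neq0; apply/allP => z.
    by rewrite mem_filter /= oppr_eq0 => /andP[].
  rewrite coefE intr_eq0 -intr_norm (ler_int _ 1) => h.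
  by lia.
have x_nz : x \in nz by rewrite mem_filter x0 -root_prod_XsubC -prs.
apply: le_trans prod_ge1 _.
rewrite (perm_big _ (perm_to_rem x_nz)) big_cons /=.
rewrite ler_wpM2l //.
apply: (@le_trans _ _ (\prod_(z <- rem x nz) B%:R)).
  rewrite !big_seq; apply: ler_prod => z /mem_rem.
  rewrite mem_filter => /andP[_ zrs]; rewrite normr_ge0 root_norm //.
  by rewrite prs root_prod_XsubC.
rewrite big_const_seq iter_mulr_1 count_predT ler_weXn2l //.
by rewrite -size_rs (leq_trans (size_subseq (rem_subseq _ _))) // size_filter count_size.
Qed.

(** The matrix is [M] tensored with the identity. This brings operators for different numbers onto
    one common eigenvector. *)
Lemma int_op_tensorl (I J : finType) (v : I -> C) (w : J -> C) B x :
  int_op v B x -> int_op (fun p : I * J => v p.1 * w p.2) B x.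
Proof.
move=> [M [Mv MB]].
exists (fun p q => if q.2 == p.2 then M p.1 q.1 else 0); split; case=> i j /=.
  rewrite mulrA Mv mulr_suml.
  under eq_bigr => k _ do rewrite (fun_if intr).
  rewrite -(pair_bigA _ (fun k l => (if l == j then (M i k)%:~R else 0%:~R) * (v k * w l))) /=.
  apply: eq_bigr => k _; rewrite (bigD1 j) //= eqxx big1 ?addr0 ?mulrA // => l /negbTE ->.
  by rewrite mul0r.
rewrite -(pair_bigA _ (fun k l => absz (if l == j then M i k else 0))) /=.
apply: leq_trans (MB i); apply: leq_sum => k _.
by rewrite (bigD1 j) //= eqxx big1 ?addn0 // => l /negbTE ->.
Qed.

Lemma int_op_tensorr (I J : finType) (v : I -> C) (w : J -> C) B x :
  int_op w B x -> int_op (fun p : I * J => v p.1 * w p.2) B x.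
Proof.
move=> [M [Mv MB]].
exists (fun p q => if q.1 == p.1 then M p.2 q.2 else 0); split; case=> i j /=.
  rewrite mulrCA Mv mulr_sumr.
  under [RHS]eq_bigr => k _ do rewrite (fun_if intr).
  rewrite -(pair_bigA _ (fun k l => (if k == i then (M j l)%:~R else 0%:~R) * (v k * w l))) /=.
  rewrite (bigD1 i) //= [X in _ + X]big1 ?addr0; last first.
    by move=> k /negbTE ->; rewrite big1 // => l _; rewrite mul0r.
  by apply: eq_bigr => l _; rewrite eqxx mulrCA.
rewrite -(pair_bigA _ (fun k l => absz (if k == i then M j l else 0))) /=.
rewrite (bigD1 i) //= [X in (_ + X)%N]big1 ?addn0; last first.
  by move=> k /negbTE ->; rewrite big1.
by apply: leq_trans (MB j); rewrite eqxx.
Qed.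

(** The matrix is the companion matrix of [p] times the leading coefficient, which makes it
    integral. *)
Lemma int_op_root (p : {poly int}) n (y : C) :
  size p = n.+1 -> root (map_poly intr p) y ->
  int_op (fun i : 'I_n => y ^+ i) (int_poly_norm p) ((lead_coef p)%:~R * y).
Proof.
move=> szp py; set c := lead_coef p.
have cE : c = p`_n by rewrite /c lead_coefE szp.
have pyE : c%:~R * y ^+ n = - \sum_(i < n) (p`_i)%:~R * y ^+ i.
  have p0 : p != 0 by rewrite -size_poly_gt0 szp.
  have szp' : size (map_poly intr p : {poly C}) = n.+1.
    by rewrite size_map_inj_poly ?szp //; apply: intr_inj.
  move: py; rewrite rootE horner_coef szp' big_ord_recr /= !coef_map /= -cE.
  rewrite addrC addr_eq0 => /eqP ->; congr (- _).
  by apply: eq_bigr => i _; rewrite coef_map.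
have sumE : int_poly_norm p = ((\sum_(i < n) absz (p`_i)%R) + absz c)%N.
  by rewrite /int_poly_norm szp big_ord_recr /= cE.
exists (fun i j : 'I_n => if i.+1 == n then - p`_j else if j == i.+1 :> nat then c else 0).
split=> i; case: (eqVneq i.+1 n) => iE.
- rewrite -mulrA -exprS iE pyE -sumrN; apply: eq_bigr => j _.
  by rewrite rmorphN mulNr.
- have lt_i : (i.+1 < n)%N by rewrite ltn_neqAle iE ltn_ord.
  rewrite -mulrA -exprS (bigD1 (Ordinal lt_i)) //= eqxx big1 ?addr0 // => j jE.
  rewrite ifN ?mul0r //; apply: contraNneq jE => jE; exact/eqP/val_inj.
- rewrite sumE; apply: leq_trans (leq_addr _ _).
  by apply: leq_sum => j _; rewrite abszN.
- have lt_i : (i.+1 < n)%N by rewrite ltn_neqAle iE ltn_ord.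
  rewrite (bigD1 (Ordinal lt_i)) //= eqxx big1 ?addn0 ?sumE ?leq_addl // => j jE.
  rewrite ifN //; apply: contraNneq jE => jE; exact/eqP/val_inj.
Qed.

End IntOp.

(** * Hermite-Pade forms *)

Section ODE.
Variable R : realType.

Lemma is_derive_expRZ (c x : R) : is_derive x 1 (fun t => expR (c * t)) (c * expR (c * x)).
Proof.
have hc : is_derive x 1 (fun t : R => c * t) c.
  have := is_derive_poly (c *: 'X) x.
  rewrite derivZ derivX hornerZ hornerC mulr1.
  by congr is_derive; apply/funext => t; rewrite hornerZ hornerX.
have := is_derive1_comp (is_derive_expR (c * x)) hc.
by rewrite mulrC.
Qed.

(** Integrating factor: [y t * expR (- c * t)] vanishes at 0 and has a nonnegative derivative, so
    the mean value theorem gives its sign. *)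
Lemma linear_ode_ge0 (y f : R -> R) (c : R) :
  (forall x : R, is_derive x 1 y (c * y x + f x)) -> y 0 = 0 ->
  (forall x : R, 0 <= x -> 0 <= f x) -> forall x : R, 0 <= x -> 0 <= y x.
Proof.
move=> dy y0 f_ge0 x x_ge0.
pose g t := y t * expR (- c * t).
have dg (t : R) : is_derive t 1 g (f t * expR (- c * t)).
  have := is_deriveM (dy t) (is_derive_expRZ (- c) t).
  have -> : y t *: (- c * expR (- c * t)) + expR (- c * t) *: (c * y t + f t)
    = f t * expR (- c * t) by rewrite /GRing.scale /=; ring.
  by [].
have cg : {within `[0, x], continuous g}.
  apply: derivable_within_continuous => t _.
  by have := dg t => -[].
have [t tx] := MVT_segment x_ge0 (fun t _ => dg t) cg.
rewrite /g y0 mul0r !subr0 => gE.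
have: 0 <= y x * expR (- c * x).
  rewrite gE mulr_ge0 // mulr_ge0 ?expR_ge0 // f_ge0 //.
  by move: tx; rewrite in_itv /= => /andP[].
by rewrite pmulr_lge0 // expR_gt0.
Qed.

End ODE.

Section Hermite.
Variable R : realType.

(** Integer coordinates with respect to divided powers, on which differentiation is a mere shift. *)
Definition divided_poly (n : nat) (b : nat -> int) : {poly R} :=
  \poly_(i < n) ((b i)%:~R / i`!%:R).

Lemma coef_divided_poly n b i : (forall j, (n <= j)%N -> b j = 0) ->
  (divided_poly n b)`_i = (b i)%:~R / i`!%:R.
Proof. by rewrite coef_poly; case: ltnP => // ni /(_ _ ni) ->; rewrite mul0r. Qed.

Definition exp_sum (K L : nat) (m : nat -> nat) (b : nat -> nat -> int) (w : R) : R :=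
  \sum_(k < K.+1) (divided_poly (m k) (b k)).[w] * expR (k%:R / L%:R * w).

Lemma is_derive_exp_sum K L m b (P : nat -> {poly R}) (w : R) :
  (forall k, (k <= K)%N ->
     P k = (divided_poly (m k) (b k))^`() + (k%:R / L%:R) *: divided_poly (m k) (b k)) ->
  is_derive w 1 (exp_sum K L m b) (\sum_(k < K.+1) (P k).[w] * expR (k%:R / L%:R * w)).
Proof.
move=> PE.
pose h (k : 'I_K.+1) : R -> R := fun w =>
  (divided_poly (m k) (b k)).[w] * expR (k%:R / L%:R * w).
have dh k : is_derive w 1 (h k) ((P k).[w] * expR (k%:R / L%:R * w)).
  have := is_deriveM (is_derive_poly (divided_poly (m k) (b k)) w)
    (is_derive_expRZ (k%:R / L%:R) w).
  rewrite (PE k (ltn_ord k)) hornerD hornerZ /GRing.scale /=.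
  set p := (divided_poly _ _).[w]; set e := expR _; set p' := _.[w].
  have -> : (p' + k%:R / L%:R * p) * e = p * (k%:R / L%:R * e) + e * p' by ring.
  by [].
have := is_derive_sum dh.
have -> : \sum_(k < K.+1) h k = exp_sum K L m b by apply/funext => t; rewrite fct_sumE.
by [].
Qed.


Lemma is_derive_divided_power (s : nat) (w : R) :
  is_derive w 1 (fun t => t ^+ s.+1 / s.+1`!%:R) (w ^+ s / s`!%:R).
Proof.
have := is_derive_poly ((s.+1`!%:R)^-1 *: 'X^(s.+1)) w.
have -> : horner ((s.+1`!%:R)^-1 *: 'X^(s.+1)) = (fun t : R => t ^+ s.+1 / s.+1`!%:R).
  by apply/funext => t; rewrite hornerZ hornerXn mulrC.
rewrite derivZ derivXn hornerZ hornerMn hornerXn /= factS natrM invfM -[w ^+ s *+ _]mulr_natl.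
by rewrite mulrACA mulVf ?pnatr_eq0 // mul1r [X in is_derive _ _ _ X]mulrC.
Qed.

(* [s.+1] is the number of equations solved so far. In the variable [w = L z] the
   differences of the exponents [k / L] are inverses of integers as soon as [L] is divisible
   by all [d <= K]; together with the basis [w ^+ i / i`!] this keeps the
   coefficients [b k i] integral. The weight [(2 * L) ^ i] absorbs the geometric
   sums that arise when inverting [D + (k - j) / L] on polynomials. *)
Definition hermite_data K L (m : nat -> nat) s (b : nat -> nat -> int) : Prop :=
  [/\ forall k i, (k <= K)%N -> (m k <= i)%N -> b k i = 0,
      forall k i, (k <= K)%N -> (absz (b k i) * (2 * L) ^ i <= (2 * L * K.+1) ^ s)%N &
      forall w : R, 0 <= w -> w ^+ s / s`!%:R <= exp_sum K L m b w /\
        exp_sum K L m b w <= w ^+ s / s`!%:R * expR (K%:R / L%:R * w)].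

Lemma hermite_data0 K L m :
  (0 < m 0)%N -> exists b, hermite_data K L m 0 b.
Proof.
move=> m0; exists (fun k i => if (k == 0) && (i == 0) then 1 else 0)%N; split.
- by move=> [|k] [|i] //= _; rewrite leqNgt m0.
- by move=> [|k] [|i].
move=> w w0; rewrite expr0 fact0 invr1 mulr1 mul1r.
have -> : exp_sum K L m (fun k i => if (k == 0) && (i == 0) then 1 else 0)%N w = 1.
  rewrite /exp_sum big_ord_recl big1 ?addr0 /=.
    rewrite mul0r mul0r expR0 mulr1 horner_poly.
    case: (m 0) m0 => // n _; rewrite big_ord_recl big1 ?addr0 /=.
      by rewrite expr0 fact0 divr1 mulr1.
    by move=> i _; rewrite mul0r mul0r.
  move=> k _; rewrite horner_poly big1 ?mul0r // => i _.
  by rewrite mul0r mul0r.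
by split=> //; rewrite -[leLHS]expR0 ler_expR mulr_ge0 // divr_ge0.
Qed.

(** The coefficient relation is the equation y' = (j / L) y + f between the new form y and the old
    form f, and the vanishing sum is y(0) = 0. The differences between y and its two bounds solve
    equations of the same type with nonnegative source, so [linear_ode_ge0] applies; the upper bound
    uses j <= K. *)
Lemma exp_sum_step K L m b m' b' j s :
  (0 < L)%N -> (j <= K)%N ->
  (forall k i, (k <= K)%N -> (m k <= i)%N -> b k i = 0) ->
  (forall k i, (k <= K)%N -> (m' k <= i)%N -> b' k i = 0) ->
  (forall k i, (k <= K)%N -> L%:Z * b' k i.+1 + (k%:Z - j%:Z) * b' k i = L%:Z * b k i) ->
  \sum_(k < K.+1) b' k 0%N = 0 ->
  (forall w : R, 0 <= w -> w ^+ s / s`!%:R <= exp_sum K L m b w /\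
        exp_sum K L m b w <= w ^+ s / s`!%:R * expR (K%:R / L%:R * w)) ->
  forall w : R, 0 <= w -> w ^+ s.+1 / s.+1`!%:R <= exp_sum K L m' b' w /\
        exp_sum K L m' b' w <= w ^+ s.+1 / s.+1`!%:R * expR (K%:R / L%:R * w).
Proof.
move=> L_gt0 jK b0 b'0 bb' sum0 bF.
have L0 : L%:R != 0 :> R by rewrite pnatr_eq0 -lt0n.
pose f := exp_sum K L m b; pose y := exp_sum K L m' b'.
pose th (k : nat) : R := k%:R / L%:R.
have dy (w : R) : is_derive w 1 y (th j * y w + f w).
  pose P k : {poly R} := th j *: divided_poly (m' k) (b' k) + divided_poly (m k) (b k).
  have -> : th j * y w + f w = \sum_(k < K.+1) (P k).[w] * expR (k%:R / L%:R * w).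
    rewrite /y /f /exp_sum mulr_sumr -big_split /=; apply: eq_bigr => k _.
    by rewrite hornerD hornerZ mulrDl mulrA.
  apply: is_derive_exp_sum => k kK; apply/polyP => i.
  have b0k := fun i => b0 k i kK; have b'0k := fun i => b'0 k i kK.
  rewrite !coefD !coefZ coef_deriv !coef_divided_poly //.
  have := congr1 (fun z : int => z%:~R : R) (bb' k i kK).
  rewrite /th rmorphD !rmorphM /= rmorphB /= -!pmulrn factS natrM.
  set x := (b' k i)%:~R; set x' := (b' k i.+1)%:~R; set z := (b k i)%:~R => e.
  have i1 : i.+1%:R != 0 :> R by rewrite pnatr_eq0.
  have i0 : i`!%:R != 0 :> R by rewrite pnatr_eq0 -lt0n fact_gt0.
  rewrite -[x' / _ *+ i.+1]mulr_natr.
  have {e}-> : z = x' + (k%:R - j%:R) * x / L%:R.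
    by apply: (mulfI L0); rewrite -e; field.
  by field; rewrite nat1r i0 i1 L0.
have y0 : y 0 = 0.
  rewrite /y /exp_sum; transitivity (\sum_(k < K.+1) (b' k 0%N)%:~R : R).
    apply: eq_bigr => k _; rewrite mulr0 expR0 mulr1 horner_coef0 coef_divided_poly ?fact0
        ?divr1 //.
    by move=> i; apply: b'0; rewrite -ltnS.
  by rewrite -rmorph_sum sum0.
have dm (w : R) := is_derive_divided_power s w.
have th_ge0 k : 0 <= th k by rewrite divr_ge0.
have mono_ge0 n (w : R) : 0 <= w -> 0 <= w ^+ n / n`!%:R by move=> w0; rewrite divr_ge0 ?exprn_ge0.
move=> w w0; split; rewrite -subr_ge0.
  apply: (@linear_ode_ge0 _ (fun t => y t - t ^+ s.+1 / s.+1`!%:R)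
    (fun t => f t - t ^+ s / s`!%:R + th j * (t ^+ s.+1 / s.+1`!%:R)) (th j)) => //.
  - move=> t; have := is_deriveB (dy t) (dm t).
    set a := (X in is_derive _ _ _ X -> _); set a' := (X in _ -> is_derive _ _ _ X).
    by have -> : a = a' by rewrite /a /a'; ring.
  - by rewrite y0 expr0n mul0r subr0.
  - move=> t t0; have [h _] := bF t t0.
    by rewrite addr_ge0 ?subr_ge0 // mulr_ge0 ?mono_ge0.
apply: (@linear_ode_ge0 _ (fun t => t ^+ s.+1 / s.+1`!%:R * expR (th K * t) - y t)
    (fun t => (t ^+ s / s`!%:R * expR (th K * t) - f t) +
      (th K - th j) * (t ^+ s.+1 / s.+1`!%:R) * expR (th K * t)) (th j)) => //.
- move=> t; have := is_deriveB (is_deriveM (dm t) (is_derive_expRZ (th K) t)) (dy t).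
  set a := (X in is_derive _ _ _ X -> _); set a' := (X in _ -> is_derive _ _ _ X).
  by have -> : a = a' by rewrite /a /a' /GRing.scale /=; ring.
- by rewrite y0 expr0n !mul0r subr0.
- move=> t t0; have [_ h] := bF t t0.
  apply: addr_ge0; first by rewrite subr_ge0.
  rewrite mulr_ge0 ?expR_ge0 // mulr_ge0 ?mono_ge0 // subr_ge0.
  by rewrite ler_wpM2r ?invr_ge0 // ler_nat.
Qed.

(** For k != j the operator D + (k - j) / L is inverted on polynomials without raising the degree.
    For k = j it is plain integration, which costs one degree and supplies the free constant for
    y(0) = 0. *)
Lemma hermite_data_step K L m s b j :
  (0 < L)%N -> (forall d, (0 < d <= K)%N -> (d %| L)%N) -> (j <= K)%N ->
  hermite_data K L m s b ->
  exists b', hermite_data K L (fun k => m k + (k == j))%N s.+1 b'.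
Proof.
move=> L_gt0 dvdL jK [b0 bB bF].
(* [q k] is L / (k - j), integral because [L] is divisible by |k - j| <= K. *)
have [q qE] : exists q : nat -> int, forall k, (k <= K)%N -> k != j ->
    q k * (k%:Z - j%:Z) = L /\ (absz (q k) <= L)%N.
  exists (fun k => (L %/ (k%:Z - j%:Z))%Z) => k kK kj.
  have dv : (absz (k%:Z - j%:Z) %| L)%N by apply: dvdL; lia.
  have e : (L %/ (k%:Z - j%:Z))%Z * (k%:Z - j%:Z) = L by rewrite divzK.
  split=> //; move: e; set u := divz _ _ => e; nia.
(* [c k] solves [y' + (k - j) / L * y = b k], i.e. [c' + c / q = b]. *)
pose c k i := \sum_(r < m k) (-1) ^+ r * q k ^+ r.+1 * b k (i + r)%N.
have cS k i : (k <= K)%N -> c k i = q k * b k i - q k * c k i.+1.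
  move=> kK; have -> : c k i = \sum_(r < (m k).+1) (-1) ^+ r * q k ^+ r.+1 * b k (i + r)%N.
    by rewrite big_ord_recr /= (b0 k (i + m k)%N) ?leq_addl // mulr0 addr0.
  rewrite big_ord_recl /= addn0 expr0 expr1 mul1r; congr (_ + _).
  rewrite mulr_sumr -sumrN; apply: eq_bigr => r _.
  by rewrite /bump /= add1n addnS addSn !exprS; ring.
have c0 k i : (k <= K)%N -> (m k <= i)%N -> c k i = 0.
  by move=> kK mi; apply: big1 => r _; rewrite b0 ?mulr0 // (leq_trans mi) ?leq_addr.
(* Downward induction on [i] from the degree: the factor 2 in the weight halves the contribution of
   [c k i.+1], so the bound reproduces itself. *)
have cB k i : (k <= K)%N -> k != j -> (absz (c k i) * (2 * L) ^ i <= 2 * L * (2 * L * K.+1) ^ s)%N.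
  move=> kK kj; have [_ qL] := qE k kK kj.
  have : (m k <= i + (m k - i))%N by lia.
  move: (m k - i)%N => t; elim: t i => [|t IHt] i mit.
    by rewrite c0 //; move: mit; rewrite addn0.
  have {IHt} := IHt i.+1; rewrite addSnnS => /(_ mit).
  have := bB k i kK; rewrite (cS k i) // expnS.
  set W := ((2 * L) ^ i)%N; set Q := (_ ^ s)%N; set x := b k i; set y := c k i.+1 => h1 h2.
  have : (absz (q k * x - q k * y)%R <= L * absz x + L * absz y)%N.
    apply: (@leq_trans (absz (q k) * absz x + absz (q k) * absz y)%N).
      by have := abszM (q k) x; have := abszM (q k) y; lia.
    by apply: leq_add; rewrite leq_mul2r qL orbT.
  move=> h3; have := leq_mul h3 (leqnn W); nia.
(* For k = j the coefficients move up by one, and the new constant term cancels the values at 0 of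
   all the other terms. *)
pose b' k i := if k == j then (if i is i'.+1 then b j i' else - \sum_(k < K.+1 | k != j :> nat)
    c k 0%N)
  else c k i.
have b'0 k i : (k <= K)%N -> (m k + (k == j) <= i)%N -> b' k i = 0.
  rewrite /b'; case: eqP => [->|_] kK; last by rewrite addn0; apply: c0.
  by case: i => [|i]; rewrite addn1 // ltnS; apply: b0.
exists b'; split=> //.
- move=> k i kK; rewrite expnS /b'.
  set Q := ((2 * L * K.+1) ^ s)%N in bB cB *.
  have leQ : (2 * L * Q <= 2 * L * K.+1 * Q)%N by rewrite leq_mul2r leq_pmulr ?orbT.
  case: (eqVneq k j) => [_|kj]; last by apply: leq_trans leQ; apply: cB.
  case: i => [|i]; last by have := bB j i jK; rewrite expnS; nia.
  rewrite expn0 muln1 abszN.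
  apply: (@leq_trans (\sum_(k < K.+1 | k != j :> nat) (2 * L * Q))%N).
    elim/big_ind2: _ => // [x1 x2 y1 y2 h1 h2|k' k'j]; first by lia.
    by have := cB k' 0%N (ltn_ord k') k'j; rewrite expn0 muln1.
  apply: (@leq_trans (\sum_(k < K.+1) (2 * L * Q))%N).
    by rewrite big_mkcond leq_sum // => k' _; case: ifP.
  by rewrite sum_nat_const card_ord mulnCA mulnA.
apply: (exp_sum_step L_gt0 jK b0 b'0 _ _ bF).
- move=> k i kK; rewrite /b'; case: (eqVneq k j) => [->|kj]; first by rewrite subrr mul0r addr0.
  rewrite (cS k i kK); have [<- _] := qE k kK kj; ring.
- rewrite (bigD1 (Ordinal (jK : j < K.+1)%N)) //= {1}/b' eqxx.
  rewrite addrC; apply/eqP; rewrite subr_eq0; apply/eqP.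
  apply: eq_big => [k|k kj]; first by rewrite -val_eqE.
  by rewrite /b' ifN.
Qed.

(** The exponents are treated cyclically, a round of K + 1 steps raising every degree by one. The
    order is one less than the number of steps because the first step is the starting form 1. *)
Lemma hermite_data_exists K L rho :
  (0 < L)%N -> (forall d, (0 < d <= K)%N -> (d %| L)%N) -> (0 < rho)%N ->
  exists b, hermite_data K L (fun=> rho) (rho * K.+1).-1 b.
Proof.
move=> L_gt0 dvdL.
have weaken m m' s : (forall k, (k <= K)%N -> m k = m' k) ->
    (exists b, hermite_data K L m s b) -> exists b, hermite_data K L m' s b.
  move=> mm' [b [b0 bB bF]]; exists b; split=> //.
    by move=> k i kK; rewrite -mm' //; apply: b0.
  suff <- : exp_sum K L m b = exp_sum K L m' b by [].
  by apply/funext => w; apply: eq_bigr => k _; rewrite mm' // -ltnS.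
(* [r] rounds are complete and the exponents below [j] are done in the next one; a previous form is
   required only when r > 0. *)
have round r j : (0 < r + j)%N -> (j <= K.+1)%N ->
    (forall r', r = r'.+1 -> exists b, hermite_data K L (fun=> r) (r * K.+1).-1 b) ->
    exists b, hermite_data K L (fun k => r + (k < j))%N (r * K.+1 + j).-1 b.
  move=> rj jK hr; elim: j rj jK => [|j IHj] rj jK.
    rewrite addn0; apply: weaken (hr r.-1 _); last by lia.
    by move=> k _; rewrite ltn0 addn0.
  case: (posnP (r + j)%N) => rj0.
    have [-> ->] : r = 0%N /\ j = 0%N by lia.
    apply: weaken (hermite_data0 K L (m := fun k => (k < 1)%N) isT).
    by move=> k _; rewrite add0n.
  have [b hb] := IHj rj0 (ltnW jK).
  have := hermite_data_step L_gt0 dvdL (jK : j <= K)%N hb.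
  have -> : (r * K.+1 + j).-1.+1 = (r * K.+1 + j.+1).-1 by nia.
  by apply: weaken => k _; rewrite -addnA; congr addn; lia.
elim: rho => // r IHr _.
have rK : (0 < r + K.+1)%N by rewrite addnS.
have := round r K.+1 rK (leqnn _) (fun r' er => IHr (etrans (congr1 (leq 1) er) erefl)).
rewrite -mulSnr; apply: weaken => k kK.
by rewrite ltnS kK addn1.
Qed.

End Hermite.

(** * The gap between powers *)

Lemma leq_exp2rW e (m n : nat) : (m <= n)%N -> (m ^ e <= n ^ e)%N.
Proof. by case: e => // e mn; rewrite leq_exp2r. Qed.

(** * The approximant as an eigenvalue *)

Section Approximant.
Variable R : realType.
Local Notation toC := (real_complex R).

(** The factor in front clears all denominators: rho! those of the divided powers, powers of [n]
    those of beta, and powers of [c1] and [c2] those of [A] and [g]. *)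
Lemma int_op_approximant (I : finType) (v : I -> R[i]) (H S c1 c2 K L rho m n : nat)
    (b : nat -> nat -> int) (A g : R) :
  (forall k i, (k <= K)%N -> (absz (b k i) <= S)%N) ->
  (0 < L)%N -> (0 < m)%N -> (0 < n)%N -> (0 < H)%N -> (c1 <= H)%N -> (c2 <= H)%N ->
  int_op v H (toC (c1%:R * A)) -> int_op v H (toC (c2%:R * g)) ->
  int_op v (K.+1 * (rho * (S * rho`! * (L * m * n * H) ^ rho * H ^ K)))
    (toC (rho`!%:R * (n * c2)%:R ^+ rho * c1%:R ^+ K *
      \sum_(k < K.+1) (divided_poly R rho (b k)).[L%:R * (m%:R * g / n%:R)] * A ^+ k)).
Proof.
move=> bS L0 m0 n0 H0 c1H c2H opA opg.
have n1 : n%:R != 0 :> R by rewrite pnatr_eq0 -lt0n.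
(* The quotient rho! / i! is the falling factorial [rho ^_ (rho - i)]; the powers of the scaling
   factors that a term leaves over remain as integers. *)
have termE (k : 'I_K.+1) (i : 'I_rho) :
    rho`!%:R * (n * c2)%:R ^+ rho * c1%:R ^+ K *
      ((b k i)%:~R / i`!%:R * (L%:R * (m%:R * g / n%:R)) ^+ i * A ^+ k) =
    (b k i)%:~R * (rho ^_ (rho - i))%:R * (L * m)%:R ^+ i * (c2%:R * g) ^+ i *
      (n * c2)%:R ^+ (rho - i) * (c1%:R * A) ^+ k * c1%:R ^+ (K - k) :> R.
  have i_rho := ltnW (ltn_ord i).
  have -> : rho`!%:R = (rho ^_ (rho - i))%:R * i`!%:R :> R.
    by rewrite -natrM -[in i`!](subKn i_rho) ffact_fact // leq_subr.
  rewrite -[in (n * c2)%:R ^+ rho](subnKC i_rho) -[in c1%:R ^+ K](subnKC (ltn_ord k : k <= K)%N).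
  rewrite !exprD !natrM !exprMn exprVn.
  have i0 : i`!%:R != 0 :> R by rewrite pnatr_eq0 -lt0n fact_gt0.
  have ni : n%:R ^+ i != 0 :> R by rewrite expf_neq0.
  by field; rewrite i0 ni.
have -> : rho`!%:R * (n * c2)%:R ^+ rho * c1%:R ^+ K *
      (\sum_(k < K.+1) (divided_poly R rho (b k)).[L%:R * (m%:R * g / n%:R)] * A ^+ k) =
    \sum_(k < K.+1) \sum_(i < rho)
      (b k i)%:~R * (rho ^_ (rho - i))%:R * (L * m)%:R ^+ i * (c2%:R * g) ^+ i *
      (n * c2)%:R ^+ (rho - i) * (c1%:R * A) ^+ k * c1%:R ^+ (K - k).
  rewrite mulr_sumr; apply: eq_bigr => k _.
  rewrite horner_poly mulr_suml mulr_sumr; apply: eq_bigr => i _; exact: termE.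
rewrite rmorph_sum -[X in int_op _ (X * _)]card_ord -sum_nat_const.
apply: int_op_sum => k; rewrite rmorph_sum.
rewrite -[X in int_op _ (X * _)]card_ord -sum_nat_const.
apply: int_op_sum => i; rewrite !rmorphM !rmorphXn /= rmorph_int !rmorph_nat.
have i_rho := ltnW (ltn_ord i); have k_K : (k <= K)%N := ltn_ord k.
have op := int_opM (int_opM (int_opM (int_opM (int_opM (int_opM
  (int_op_int v (b k i)) (int_op_nat v (rho ^_ (rho - i)))) (int_opX i (int_op_nat v (L * m))))
  (int_opX i opg)) (int_opX (rho - i) (int_op_nat v (n * c2)))) (int_opX k opA))
  (int_opX (K - k) (int_op_nat v c1)).
move: op; rewrite !rmorphM /= !rmorph_nat => op.
apply: int_op_le op.
have h1 : (rho ^_ (rho - i) <= rho`!)%N.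
  by rewrite -[X in (_ <= X)%N](ffact_fact (leq_subr i rho)) leq_pmulr ?fact_gt0.
have h2 : ((L * m) ^ i * H ^ i * (n * c2) ^ (rho - i) <= (L * m * n * H) ^ rho)%N.
  rewrite -[in X in (_ <= X)%N](subnKC i_rho) expnD -expnMn.
  apply: leq_mul; apply: leq_exp2rW; first by rewrite leq_mul2r leq_pmulr ?orbT.
  rewrite -[(_ * n * H)%N]mulnA; apply: leq_trans (leq_pmull _ _); last by rewrite muln_gt0 L0.
  by rewrite leq_mul2l c2H orbT.
have h3 : (H ^ k * c1 ^ (K - k) <= H ^ K)%N.
  by rewrite -[in X in (_ <= X)%N](subnKC k_K) expnD leq_mul2l leq_exp2rW ?orbT.
rewrite -!mulnA; apply: leq_mul; first exact: bS.
apply: leq_mul => //; rewrite !mulnA -mulnA; exact: leq_mul.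
Qed.

End Approximant.

(** * Analytic size of the approximant *)

Section Size.
Variable R : realType.

Lemma expB_le (K k : nat) (E x y : R) : (k <= K)%N -> 0 <= x <= E -> 0 <= y <= E -> 1 <= E ->
  `|x ^+ k - y ^+ k| <= K%:R * E ^+ K * `|x - y|.
Proof.
move=> kK /andP[x0 xE] /andP[y0 yE] E1.
rewrite subrXX normrM mulrC ler_wpM2r //.
apply: le_trans (ler_norm_sum _ _ _) _.
apply: (@le_trans _ _ (\sum_(i < k) E ^+ K)).
  apply: ler_sum => i _; rewrite ger0_norm ?mulr_ge0 ?exprn_ge0 //.
  apply: (@le_trans _ _ (E ^+ (k.-1 - i) * E ^+ i)).
    by apply: ler_pM; rewrite ?exprn_ge0 // lerXn2r // nnegrE // (le_trans x0, le_trans y0).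
  by rewrite -exprD ler_weXn2l //; have := ltn_ord i; lia.
rewrite sumr_const card_ord -[_ *+ k]mulr_natl ler_wpM2r ?ler_nat //.
by rewrite exprn_ge0 // (le_trans ler01).
Qed.

(** Replacing e^beta by [A] changes F by at most half of 1 / s!, itself a lower bound for F because
    L beta >= 1. Hence Z stays positive and keeps the upper bound up to a factor 2. *)
Lemma approximant_bounds (K L rho s : nat) (b : nat -> nat -> int) (beta A E : R) :
  hermite_data R K L (fun=> rho) s b -> (0 < L)%N -> 0 <= beta -> 1 <= L%:R * beta ->
  0 <= A <= E -> expR beta <= E -> 1 <= E ->
  (K.+1 * rho * (2 * L * K.+1) ^ s)%:R * (L%:R * beta) ^+ rho * (K%:R * E ^+ K * `|A - expR beta|)
    <= 1 / 2 / s`!%:R ->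
  let Z := \sum_(k < K.+1) (divided_poly R rho (b k)).[L%:R * beta] * A ^+ k in
  0 < Z /\ Z <= 2 * (L%:R * beta) ^+ s * E ^+ K / s`!%:R.
Proof.
move=> [b0 bB bF] L_gt0 beta0 w1 AE bE E1 small Z.
set w := L%:R * beta in w1 small Z *.
have w0 : 0 <= w := le_trans ler01 w1.
have L0 : L%:R != 0 :> R by rewrite pnatr_eq0 -lt0n.
set S := ((2 * L * K.+1) ^ s)%N in bB small.
have kbeta k : k%:R / L%:R * w = k%:R * beta by rewrite /w mulrA divfK.
have polyB (k : 'I_K.+1) : `|(divided_poly R rho (b k)).[w]| <= (rho * S)%:R * w ^+ rho.
  rewrite horner_poly; apply: le_trans (ler_norm_sum _ _ _) _.
  apply: (@le_trans _ _ (\sum_(i < rho) S%:R * w ^+ rho)); last first.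
    by rewrite sumr_const card_ord -[_ *+ rho]mulr_natl natrM mulrA.
  apply: ler_sum => i _; rewrite normrM (ger0_norm (exprn_ge0 i w0)).
  apply: ler_pM; rewrite ?exprn_ge0 //; last by rewrite ler_weXn2l // ltnW.
  have i0 : 0 < i`!%:R :> R by rewrite ltr0n fact_gt0.
  rewrite normrM normfV (gtr0_norm i0) ler_pdivrMr // -intr_norm -natr_absz -natrM ler_nat.
  apply: (@leq_trans S); last by rewrite leq_pmulr ?fact_gt0.
  apply: leq_trans (bB k i (ltn_ord k)).
  by rewrite leq_pmulr // expn_gt0 muln_gt0 L_gt0.
have [F_ge F_le] := bF w w0; set F := exp_sum _ _ _ _ _ in F_ge F_le.
have diff : `|F - Z| <= 1 / 2 / s`!%:R.
  apply: le_trans small; rewrite /F /exp_sum /Z -sumrB.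
  apply: le_trans (ler_norm_sum _ _ _) _.
  apply: (@le_trans _ _ (\sum_(k < K.+1) (rho * S)%:R * w ^+ rho * (K%:R * E ^+ K * `|A - expR
      beta|))).
    apply: ler_sum => k _; rewrite -mulrBr normrM ler_pM // kbeta expRM_natl distrC.
    by apply: expB_le => //; [exact: (ltn_ord k)|rewrite expR_ge0].
  by rewrite sumr_const card_ord -[_ *+ K.+1]mulr_natl !natrM !mulrA.
have s0 : 0 < s`!%:R :> R by rewrite ltr0n fact_gt0.
have ws1 : 1 / s`!%:R <= w ^+ s / s`!%:R by rewrite ler_pM2r ?invr_gt0 // exprn_ege1.
have is0 : 0 < 1 / s`!%:R :> R by rewrite divr_gt0.
have half : 1 / 2 / s`!%:R = (1 / s`!%:R) / 2 :> R by rewrite mulrAC.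
move: diff; rewrite half ler_distl => /andP[d1 d2].
have EK : 1 <= E ^+ K by rewrite exprn_ege1.
have {}F_le : F <= w ^+ s / s`!%:R * E ^+ K.
  apply: le_trans F_le _; rewrite ler_wpM2l ?divr_ge0 ?exprn_ge0 //.
  by rewrite kbeta expRM_natl lerXn2r // nnegrE ?expR_ge0 // (le_trans ler01).
have p0 : 0 <= w ^+ s / s`!%:R by rewrite divr_ge0 ?exprn_ge0.
split; first by lra.
have -> : 2 * w ^+ s * E ^+ K / s`!%:R = 2 * (w ^+ s / s`!%:R) * E ^+ K by ring.
set u := w ^+ s / s`!%:R in ws1 F_le p0 *.
have : u <= u * E ^+ K by rewrite ler_peMr.
set v := u * E ^+ K in F_le *; rewrite -mulrA -/v => uv; lra.
Qed.
End Size.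

Lemma leq_self_exp c e : (0 < e)%N -> (c <= c ^ e)%N.
Proof. by case: c => // c e0; rewrite -[X in (X <= _)%N]expn1 leq_pexp2l. Qed.

Lemma leq_fact_exp n : (n`! <= n ^ n)%N.
Proof.
elim: n => // n IHn; rewrite factS expnS leq_mul2l /=.
by apply: leq_trans IHn _; apply: leq_exp2rW.
Qed.

Lemma leq_exp_fact n t : (n ^ t <= (n + t)`!)%N.
Proof.
elim: t => [|t IHt]; first by rewrite fact_gt0.
by rewrite expnS addnS factS leq_mul // -addSn leqW // leq_addr.
Qed.

Lemma sqrt_nat n : exists r, (r ^ 2 <= n < r.+1 ^ 2)%N.
Proof.
elim: n => [|n [r /andP[r1 r2]]]; first by exists 0%N.
have [h|h] := ltnP n.+1 (r.+1 ^ 2); first by exists r; rewrite h ltnW.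
by exists r.+1; rewrite h /=; lia.
Qed.

Lemma leq_succ_mul r k : (0 < r)%N -> (0 < k)%N -> (r + k.-1 * r <= (r * k.+1).-1)%N.
Proof. nia. Qed.

(** * Choice of the parameters *)

Section Constants.
Variables d H : nat.

(* [K = approx_degree] makes [rho ^ K.-1] beat the power [rho ^ (8 * d.+1)] coming from Liouville's
   inequality in dimension [d]; [cstW] controls the passage from [F(beta)] to [Z], while
   [cstU] and [cstV] bound, per unit of [rho], the Liouville constant and the
   remainder. [approx_scale] has the factor [H] to ensure [1 <= approx_scale * beta]. *)
Definition approx_degree : nat := (8 * d + 10)%N.
Definition approx_scale : nat := (approx_degree`! * H)%N.
Definition coef_base : nat := (2 * approx_scale * approx_degree.+1)%N.
Definition exp_base : nat := (4 ^ (4 * H))%N.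
Definition cstW : nat := (8 * approx_degree * approx_degree.+1 * coef_base ^ approx_degree.+1 *
    (4 * approx_scale * H) *
  exp_base ^ approx_degree.+2 * approx_degree.+1 ^ approx_degree.+1)%N.
Definition cstU : nat := (2 * approx_degree.+1 * coef_base ^ approx_degree.+1 * approx_scale *
    H ^ approx_degree.+1)%N.
Definition cstV : nat := (2 * (4 * approx_scale * H) ^ approx_degree.+1 * exp_base ^
    approx_degree)%N.
(** The first summand serves [liouville_size_lt], the second [cstW_le_expR], the last two
    [power_gap_aux]. *)
Definition rho_min : nat :=
  (cstV * cstU ^ d.+1 + cstW * (2 * H) ^ approx_degree.+2 * approx_degree.+2 ^ approx_degree.+2
      + 2 * H ^ 2 + 4)%N.

Hypothesis H_gt0 : (0 < H)%N.
Variable rho : nat.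
Hypothesis le_rho : (rho_min <= rho)%N.

Local Notation K := approx_degree.
Local Notation L := approx_scale.
Local Notation s := (rho * K.+1).-1.

Let L_gt0 : (0 < L)%N. Proof. by rewrite muln_gt0 fact_gt0. Qed.
Let Q_gt0 : (0 < coef_base)%N. Proof. by rewrite /coef_base muln_gt0 muln_gt0 L_gt0. Qed.
Let E_gt0 : (0 < exp_base)%N. Proof. by rewrite expn_gt0. Qed.
Let rho_gt0 : (0 < rho)%N. Proof. by apply: leq_trans le_rho; rewrite /rho_min addnS. Qed.

Let exp_s c : (0 < c)%N -> (c ^ s <= (c ^ K.+1) ^ rho)%N.
Proof. by move=> c0; rewrite -expnM mulnC leq_pexp2l // leq_pred. Qed.

(** Each factor is majorised by a rho-th power, s! included, so that the product can be compared
    with [expR (rho%:R / (2 * H%:R)) ^+ rho] base by base. *)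
Lemma approx_size_le :
  (4 * K.+1 * rho * coef_base ^ s * (4 * L * H) ^ rho * K * exp_base ^ K.+2 * s`! <= (cstW *
      rho ^ K.+1) ^ rho)%N.
Proof.
have h1 : (4 * K.+1 * K <= (4 * K.+1 * K) ^ rho)%N by apply: leq_self_exp.
have h2 : (rho <= 2 ^ rho)%N by rewrite ltnW // ltn_expl.
have h3 := exp_s Q_gt0.
have h4 : (exp_base ^ K.+2 <= (exp_base ^ K.+2) ^ rho)%N by apply: leq_self_exp.
have h5 : (s`! <= ((rho * K.+1) ^ K.+1) ^ rho)%N.
  rewrite -expnM [X in (_ ^ X)%N]mulnC; apply: leq_trans (leq_fact_exp _).
  by apply: leq_fact; apply: leq_pred.
have := leq_mul (leq_mul (leq_mul (leq_mul (leq_mul h1 h2) h3) (leqnn ((4 * L * H) ^ rho)%N))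
    h4) h5.
rewrite -!expnMn; congr (_ <= _)%N; first by ring.
by congr (_ ^ _)%N; rewrite /cstW expnMn; ring.
Qed.

(** Up to rho-th powers of constants the left side is rho^(8 (d+1) rho): of the 8, one comes from
    rho! and seven from m n. The right side is at least rho^((K-1) rho), and K - 1 = 8 (d+1) + 1
    leaves one factor rho to beat the constants. *)
Lemma liouville_size_lt m n : (m * n <= rho ^ 7)%N ->
  (2 * (4 * L * H) ^ s * exp_base ^ K *
    (K.+1 * (rho * (coef_base ^ s * rho`! * (L * m * n * H) ^ rho * H ^ K))) ^ d.+1 < s`!)%N.
Proof.
move=> mn.
have hB : (K.+1 * (rho * (coef_base ^ s * rho`! * (L * m * n * H) ^ rho * H ^ K)) <= (cstU *
    rho ^ 8) ^ rho)%N.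
  have h1 : (K.+1 <= K.+1 ^ rho)%N by apply: leq_self_exp.
  have h2 : (rho <= 2 ^ rho)%N by rewrite ltnW // ltn_expl.
  have h3 := exp_s Q_gt0.
  have h4 := leq_fact_exp rho.
  have h5 : ((L * m * n * H) ^ rho <= (L * rho ^ 7 * H) ^ rho)%N.
    by apply: leq_exp2rW; rewrite -[(L * m * n)%N]mulnA leq_mul2r leq_mul2l mn !orbT.
  have h6 : (H ^ K <= (H ^ K) ^ rho)%N by apply: leq_self_exp.
  have := leq_mul h1 (leq_mul h2 (leq_mul (leq_mul (leq_mul h3 h4) h5) h6)).
  rewrite -!expnMn; congr (_ <= _)%N.
  by congr (_ ^ _)%N; rewrite /cstU (expnS H) (expnS rho 7); ring.
have hV : (2 * (4 * L * H) ^ s * exp_base ^ K <= cstV ^ rho)%N.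
  have h1 : (2 <= 2 ^ rho)%N by apply: leq_self_exp.
  have LH : (0 < 4 * L * H)%N by rewrite muln_gt0 muln_gt0 L_gt0.
  have h2 := exp_s LH.
  have h3 : (exp_base ^ K <= (exp_base ^ K) ^ rho)%N by apply: leq_self_exp.
  by have := leq_mul (leq_mul h1 h2) h3; rewrite -!expnMn.
apply: leq_ltn_trans (leq_mul hV (leq_exp2rW d.+1 hB)) _.
rewrite -expnM [X in (_ * _ ^ X)%N]mulnC expnM -expnMn.
have lt1 : (cstV * (cstU * rho ^ 8) ^ d.+1 < rho ^ K.-1)%N.
  have -> : K.-1 = (8 * d.+1).+1 by rewrite /K; lia.
  rewrite expnMn mulnA -expnM (expnS rho) ltn_pmul2r ?expn_gt0 ?rho_gt0 //.
  apply: leq_trans le_rho.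
  have lt4 x y z t : (x < x + y + z + t.+1)%N by clear; lia.
  exact: lt4.
apply: (@leq_trans ((rho ^ K.-1) ^ rho)%N); first by rewrite ltn_exp2r.
rewrite -expnM; apply: leq_trans (leq_exp_fact _ _) _; apply: leq_fact.
by apply: leq_succ_mul => //; rewrite /K addnS.
Qed.

Lemma rho_bounds : [/\ (2 * H ^ 2 <= rho)%N, (4 <= rho)%N &
   (cstW * (2 * H) ^ K.+2 * K.+2 ^ K.+2 <= rho)%N].
Proof.
have le3 x y z t : (x + y + z + t <= rho)%N -> [/\ z <= rho, t <= rho & y <= rho]%N.
  by clear; split; lia.
exact: le3 le_rho.
Qed.

(** The term of degree K + 2 in the exponential series outgrows rho^(K+1). *)
Lemma cstW_le_expR (R : realType) :
  (cstW * rho ^ K.+1)%:R <= expR (rho%:R / (2 * H%:R)) :> R.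
Proof.
have [_ _ h] := rho_bounds.
rewrite -(natrM _ 2).
have x0 : 0 <= rho%:R / (2 * H)%:R :> R by rewrite divr_ge0.
apply: le_trans (_ : (rho%:R / (2 * H)%:R) ^+ K.+2 / K.+2`!%:R <= _).
  rewrite expr_div_n ler_pdivlMr ?ltr0n ?fact_gt0 // ler_pdivlMr; last first.
    by rewrite exprn_gt0 // ltr0n muln_gt0.
  rewrite -!natrX -!natrM ler_nat.
  rewrite [X in (_ <= X)%N]expnS mulnAC.
  have := leq_fact_exp K.+2; move: h; set a := cstW; set f := K.+2`!; set k := (K.+2 ^ K.+2)%N.
  set e := ((2 * H) ^ K.+2)%N; set r := (rho ^ K.+1)%N => h1 h2.
  have -> : (a * r * e * f = r * (a * e * f))%N by ring.
  rewrite [(rho * r)%N]mulnC leq_mul2l; apply/orP; right.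
  by apply: leq_trans h1; rewrite leq_mul2l h2 orbT.
have := expR_ge1Dxn K.+1 x0; lra.
Qed.

End Constants.

(** * Consequences of a small gap *)

Section Gap.
Variable R : realType.
Local Notation toC := (real_complex R).

Lemma expR1_le4 : expR 1 <= 4 :> R.
Proof.
have h : expR (1 / 2) <= 2 :> R.
  have := expR_ge1Dx (- (1 / 2) : R); rewrite expRN.
  have e0 := expR_gt0 (1 / 2 : R).
  rewrite -(ler_pM2r e0) mulVf ?gt_eqF // => ?; lra.
have -> : 1 = 1 / 2 + 1 / 2 :> R by lra.
rewrite expRD; have := expR_gt0 (1 / 2 : R); nra.
Qed.

Lemma expR_le_expn (x : R) (n : nat) : x <= n%:R -> expR x <= (4 ^ n)%:R.
Proof.
move=> xn; apply: le_trans (_ : expR n%:R <= _); first by rewrite ler_expR.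
rewrite -[n%:R]mulr1 expRM_natl natrX lerXn2r // ?nnegrE ?expR_ge0 //.
exact: expR1_le4.
Qed.

Lemma subrX_ge (n : nat) (a b : R) : (0 < n)%N -> 0 <= a -> 0 <= b ->
  `|a - b| * a ^+ n.-1 <= `|a ^+ n - b ^+ n|.
Proof.
case: n => // n _ a0 b0; rewrite subrXX normrM ler_wpM2l //.
rewrite big_ord_recl /= subn0 expr0 mulr1 ger0_norm ?lerDl ?sumr_ge0 //.
  by move=> i _; rewrite mulr_ge0 ?exprn_ge0.
rewrite addr_ge0 ?exprn_ge0 // sumr_ge0 // => i _.
by rewrite mulr_ge0 ?exprn_ge0.
Qed.

(** With a = e^ell and b = e^(beta/2), factoring a^n - b^n gives |a - b| a^(n-1) <= a^(n/2), that is
    |a - b| <= a e^(-n ell / 2). Then n >= rho^2 and H ell >= 1 turn this into a bound in rho. *)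
Lemma power_gap_aux (H : nat) (ell g : R) (m n rho : nat) :
  (0 < H)%N -> 1 <= H%:R * ell -> ell <= H%:R -> 1 <= H%:R * g -> g <= H%:R ->
  (0 < m)%N -> (2 * H ^ 2 <= rho)%N -> (4 <= rho)%N -> (rho ^ 2 <= n < rho.+1 ^ 2)%N ->
  `|expR (n%:R * ell) - expR (m%:R * g)| <= expR (n%:R * ell / 2) ->
  let beta := m%:R * (2 * g) / n%:R in
  [/\ (m * n <= rho ^ 7)%N, 1 <= H%:R * beta, beta <= (4 * H)%:R &
    `|expR (2 * ell) - expR beta| <= 2 * (exp_base H)%:R ^+ 2 / expR (rho%:R / (2 * H%:R)) ^+ rho].
Proof.
move=> H0 Hl lH Hg gH m0 rhoH rho4 /andP[rn nr] close beta.
have n16 : (16 <= n)%N by nia.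
have n_gt0 : (0 < n)%N by lia.
have Hn2 : (H * (n * H + 1) <= 2 * H ^ 2 * n)%N by nia.
have Hn : (2 * H <= n)%N by nia.
have n3 : (n <= rho ^ 3)%N by nia.
have H1 : 1 <= H%:R :> R by rewrite (ler_nat _ 1).
have n0 : 0 < n%:R :> R by rewrite ltr0n; lia.
have l0 : 0 < ell by nra.
have g0 : 0 < g by nra.
have nl2 : 2 <= n%:R * ell.
  have : (2 * H)%:R <= n%:R :> R by rewrite ler_nat.
  by rewrite natrM => h; nra.
set x := n%:R * ell in close nl2 *; set y := m%:R * g in close *.
have ex2 : expR x = expR (x / 2) * expR (x / 2) by rewrite -expRD; congr expR; lra.
have h2 : 2 <= expR (x / 2) by have := expR_ge1Dx (x / 2); lra.
have e1 : 2 <= expR 1 :> R by have := expR_ge1Dx (1 : R); lra.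
have ex0 := expR_gt0 x; have ey0 := expR_gt0 y.
move: (close); rewrite ler_distl => /andP[c1 c2].
(* A crude consequence of closeness: the exponents [x] and [y] differ by at most 1, which controls
   [m] and [beta]. *)
have yx : y <= x + 1.
  by rewrite -ler_expR expRD; nra.
have xy : x <= y + 1.
  by rewrite -ler_expR expRD; nra.
have nb : n%:R * beta = 2 * y by rewrite /beta /y; field; rewrite gt_eqF.
have bub : beta <= (4 * H)%:R.
  rewrite -(ler_pM2l n0) nb natrM.
  have : x <= n%:R * H%:R by rewrite ler_pM2l.
  have : 1 <= n%:R * H%:R :> R by rewrite -natrM (ler_nat _ 1) muln_gt0 n_gt0.
  lra.
have blb : ell <= beta by rewrite -(ler_pM2l n0) nb -/x; lra.
split => //.
- have mn : (m <= H * (n * H + 1))%N.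
    rewrite -(ler_nat R) natrM natrD natrM.
    have : m%:R <= H%:R * y by rewrite /y mulrCA ler_peMr.
    have : H%:R * y <= H%:R * (n%:R * H%:R + 1).
      rewrite ler_pM2l; last by lra.
      have : x <= n%:R * H%:R by rewrite ler_pM2l.
      lra.
    lra.
  have mn2 : (m <= 2 * H ^ 2 * n)%N by apply: leq_trans mn _.
  have mr : (m <= rho * rho ^ 3)%N by apply: leq_trans mn2 _; apply: leq_mul.
  rewrite (expnD rho 4 3) (expnS rho 3); exact: leq_mul.
- by apply: le_trans Hl _; rewrite ler_pM2l //; lra.
pose a := expR ell; pose b := expR (beta / 2).
have a0 : 0 < a by apply: expR_gt0.
have b0 : 0 < b by apply: expR_gt0.
have aE : a <= (exp_base H)%:R.
  by apply: expR_le_expn; apply: le_trans lH _; rewrite ler_nat leq_pmull.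
have bE : b <= (exp_base H)%:R.
  by apply: expR_le_expn; have : 0 <= (4 * H)%:R :> R by []; lra.
have an : a ^+ n = expR x by rewrite /a -expRM_natl.
have bn : b ^+ n = expR y by rewrite /b -expRM_natl; congr expR; rewrite mulrA nb; lra.
have := subrX_ge n_gt0 (ltW a0) (ltW b0); rewrite an bn => hab.
have {}hab : `|a - b| * expR (x / 2) <= a.
  have e0 := expR_gt0 (x / 2).
  rewrite -(ler_pM2r e0) -mulrA -ex2 -an -(prednK n_gt0) exprSr mulrA mulrC ler_pM2l //.
  exact: le_trans hab close.
have -> : expR (2 * ell) = a * a by rewrite /a -expRD; congr expR; lra.
have -> : expR beta = b * b by rewrite /b -expRD; congr expR; lra.
have -> : a * a - b * b = (a - b) * (a + b) by ring.
rewrite normrM (gtr0_norm (addr_gt0 a0 b0)).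
set D := `|a - b| in hab *; have D0 : 0 <= D by apply: normr_ge0.
set e := expR (_ / _) ^+ rho; have e0 : 0 < e by rewrite exprn_gt0 ?expR_gt0.
have ee : e <= expR (x / 2).
  rewrite /e -expRM_natl ler_expR /x.
  have Hp : 0 < 2 * H%:R :> R by lra.
  rewrite mulrA ler_pdivrMr //.
  have : (rho * rho)%:R <= n%:R :> R by rewrite ler_nat mulnn.
  rewrite natrM => hr; apply: le_trans hr _.
  have -> : n%:R * ell / 2 * (2 * H%:R) = n%:R * (H%:R * ell) by field.
  by rewrite ler_peMr // ltW.
rewrite ler_pdivlMr // expr2.
have hD : D * e <= (exp_base H)%:R by apply: le_trans aE; apply: le_trans hab; rewrite ler_wpM2l.
rewrite mulrAC [X in _ <= X]mulrCA; apply: ler_pM => //; first by rewrite mulr_ge0 // ltW.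
  by rewrite addr_ge0 // ltW.
lra.
Qed.

End Gap.

(** * Liouville's inequality against the upper bound *)

Section MainGap.
Variable R : realType.
Local Notation toC := (real_complex R).

Lemma int_op_liouville_real (I : finType) (v : I -> R[i]) B (x : R) :
  (exists i, v i != 0) -> int_op v B (toC x) -> x != 0 -> 1 <= `|x| * B%:R ^+ #|I|.
Proof.
move=> v0 opx x0; have := int_op_liouville v0 opx _.
rewrite -lecR; rewrite (fmorph_eq0 toC) => /(_ x0).
by rewrite normc_def /= expr0n addr0 sqrtr_sqr rmorphM rmorphXn /= rmorph_nat.
Qed.

Lemma power_gap (I : finType) (v : I -> R[i]) (d H c1 c2 : nat) (ell g : R) (n m : nat) :
  (exists i, v i != 0) -> (#|I| <= d)%N -> (0 < c1 <= H)%N -> (0 < c2 <= H)%N ->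
  int_op v H (toC (c1%:R * expR (2 * ell))) -> int_op v H (toC (c2%:R * (2 * g))) ->
  1 <= H%:R * ell -> ell <= H%:R -> 1 <= H%:R * g -> g <= H%:R ->
  ((rho_min d H).+1 ^ 2 <= n)%N -> (0 < m)%N ->
  expR (n%:R * ell / 2) < `|expR (n%:R * ell) - expR (m%:R * g)|.
Proof.
move=> v0 Id /andP[c10 c1H] /andP[c20 c2H] opA opg Hl lH Hg gH nbig m0.
rewrite ltNge; apply/negP => close.
have H0 : (0 < H)%N := leq_trans c10 c1H.
(* Taking rho about the square root of [n] makes the closeness, of order exp(- rho^2 / (2 H)), beat
   every quantity of the form rho^(O(rho)). *)
have [rho /andP[rn nr]] := sqrt_nat n.
have le_rho : (rho_min d H <= rho)%N.
  by move: (leq_ltn_trans nbig nr); rewrite ltn_exp2r // => /ltnW.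
have [rhoH rho4 _] := rho_bounds le_rho.
have rnr : (rho ^ 2 <= n < rho.+1 ^ 2)%N by rewrite rn.
have [mn Hb bub etaB] := power_gap_aux H0 Hl lH Hg gH m0 rhoH rho4 rnr close.
set beta := m%:R * (2 * g) / n%:R in Hb bub etaB.
pose K := approx_degree d; pose L := approx_scale d H; pose s := (rho * K.+1).-1.
have L0 : (0 < L)%N by rewrite muln_gt0 fact_gt0.
have rho0 : (0 < rho)%N := leq_trans (isT : 0 < 4)%N rho4.
have n0 : (0 < n)%N by apply: leq_trans nbig; rewrite expn_gt0.
have dvdL e : (0 < e <= K)%N -> (e %| L)%N.
  by move=> eK; rewrite dvdn_mulr // dvdn_fact.
have [b hb] := hermite_data_exists R L0 dvdL rho0.
have beta0 : 0 <= beta.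
  have : 0 < H%:R :> R by rewrite ltr0n.
  by move=> h; rewrite -(pmulr_rge0 _ h); lra.
have w1 : 1 <= L%:R * beta.
  by apply: le_trans Hb _; rewrite ler_wpM2r // ler_nat /L /approx_scale leq_pmull // fact_gt0.
have w0 : 0 <= L%:R * beta := le_trans ler01 w1.
have wub : L%:R * beta <= (4 * L * H)%:R.
  by rewrite mulnAC mulnC natrM ler_wpM2l.
have E1 : 1 <= (exp_base H)%:R :> R by rewrite (ler_nat _ 1) expn_gt0.
have AE : 0 <= expR (2 * ell) <= (exp_base H)%:R.
  rewrite expR_ge0 expR_le_expn //; rewrite natrM; lra.
have bE := expR_le_expn bub; rewrite -/(exp_base H) in bE.
have small : (K.+1 * rho * (2 * L * K.+1) ^ s)%:R * (L%:R * beta) ^+ rho *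
    (K%:R * (exp_base H)%:R ^+ K * `|expR (2 * ell) - expR beta|) <= 1 / 2 / s`!%:R.
  set e := expR _ ^+ rho in etaB.
  have e0 : 0 < e by rewrite exprn_gt0 ?expR_gt0.
  have s0 : 0 < s`!%:R :> R by rewrite ltr0n fact_gt0.
  have big : (4 * K.+1 * rho * coef_base d H ^ s * (4 * L * H) ^ rho * K * exp_base H ^ K.+2 *
      s`!)%:R <= e.
    apply: le_trans (_ : ((cstW d H * rho ^ K.+1)%:R) ^+ rho <= _).
      by rewrite -natrX ler_nat; apply: approx_size_le.
    by rewrite lerXn2r // ?nnegrE ?expR_ge0 //; apply: cstW_le_expR.
  apply: (@le_trans _ _ ((K.+1 * rho * coef_base d H ^ s)%:R * (4 * L * H)%:R ^+ rho *
    (K%:R * (exp_base H)%:R ^+ K * (2 * (exp_base H)%:R ^+ 2 / e)))).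
    have wY : (L%:R * beta) ^+ rho <= (4 * L * H)%:R ^+ rho.
      by rewrite lerXn2r // nnegrE.
    have KE : 0 <= K%:R * (exp_base H)%:R ^+ K :> R by rewrite mulr_ge0 ?exprn_ge0.
    apply: ler_pM; [| |exact: ler_wpM2l|exact: ler_wpM2l].
      by rewrite mulr_ge0 ?exprn_ge0.
    by rewrite mulr_ge0.
  rewrite ler_pdivlMr //.
  set X := (_ * rho * _)%:R; set Y := _%:R ^+ rho; set k := K%:R; set EB := (exp_base H)%:R;
      set f := s`!%:R.
  have -> : X * Y * (k * EB ^+ K * (2 * EB ^+ 2 / e)) * f = (X * Y * k * (EB ^+ K.+2) * 2 * f) / e.
    by rewrite -[K.+2]addn2 exprD; ring.
  rewrite ler_pdivrMr //; move: big.
  have -> : (4 * K.+1 * rho * coef_base d H ^ s * (4 * L * H) ^ rho * K * exp_base H ^ K.+2 *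
      s`!)%:R
    = 4 * (X * Y * k * EB ^+ K.+2 * f).
    by rewrite /X /Y /k /EB /f -!natrX -!natrM; congr (_%:R); ring.
  lra.
have [Z0 ZB] := approximant_bounds hb L0 beta0 w1 AE bE E1 small.
set Z := (\sum_(k < K.+1) _) in Z0 ZB.
have bS k i : (k <= K)%N -> (absz (b k i) <= coef_base d H ^ s)%N.
  move=> kK; have [_ bB _] := hb; apply: leq_trans (bB k i kK).
  by rewrite leq_pmulr // expn_gt0 muln_gt0 L0.
have := int_op_approximant rho bS L0 m0 n0 H0 c1H c2H opA opg.
rewrite -/beta -/Z; set B := (K.+1 * _)%N; set c := rho`!%:R * _ * _ => op.
have cE : c = (rho`! * (n * c2) ^ rho * c1 ^ K)%:R by rewrite /c !natrM !natrX natrM.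
have c_ge1 : 1 <= c.
  by rewrite cE (ler_nat _ 1) !muln_gt0 fact_gt0 !expn_gt0 muln_gt0 n0 c20 c10.
have c0 : 0 < c := lt_le_trans ltr01 c_ge1.
(* The scaling factor is absorbed by one more power of [B], whence the exponent d + 1. *)
have cB : c <= B%:R.
  rewrite cE ler_nat /B; apply: leq_trans (leq_pmull _ _) => //.
  apply: leq_trans (leq_pmull _ rho0); apply: leq_mul; last exact: leq_exp2rW.
  apply: leq_mul; first by rewrite leq_pmull // expn_gt0 /coef_base muln_gt0 muln_gt0 L0.
  apply: leq_exp2rW; apply: leq_mul => //.
  by rewrite leq_pmull // muln_gt0 L0.
have B1 : 1 <= B%:R :> R := le_trans c_ge1 cB.
have cZ0 : 0 < c * Z by rewrite mulr_gt0.
have := int_op_liouville_real v0 op (lt0r_neq0 cZ0); rewrite gtr0_norm // => lv.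
have : 1 <= Z * B%:R ^+ d.+1.
  apply: le_trans lv _; rewrite mulrAC mulrC exprS ler_pM2l //.
  by apply: ler_pM => //; rewrite ?exprn_ge0 ?ler0n ?ler_weXn2l // ltW.
apply/negP; rewrite -ltNge.
apply: le_lt_trans (_ : 2 * (L%:R * beta) ^+ s * (exp_base H)%:R ^+ K / s`!%:R * B%:R ^+ d.+1 < 1).
  by rewrite ler_wpM2r ?exprn_ge0.
rewrite mulrAC ltr_pdivrMr ?ltr0n ?fact_gt0 // mul1r.
have := liouville_size_lt H0 le_rho mn; rewrite -/K -/L -/s -/B.
rewrite -(ltr_nat R); apply: le_lt_trans.
have -> : (2 * (4 * L * H) ^ s * exp_base H ^ K * B ^ d.+1)%:R =
    2 * (4 * L * H)%:R ^+ s * (exp_base H)%:R ^+ K * B%:R ^+ d.+1 :> R.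
  by rewrite -!natrX -!natrM.
rewrite ler_wpM2r ?exprn_ge0 // ler_wpM2r ?exprn_ge0 // ler_wpM2l //.
by rewrite lerXn2r // nnegrE ?mulr_ge0 // (le_trans ler01).
Qed.

End MainGap.

(** * Counting *)

Section Counting.
Variable R : realType.

Lemma card_fset_set_le (T : choiceType) (A : set T) (s : seq T) :
  A `<=` [set` s] -> finite_set A /\ (#|` fset_set A| <= size s)%N.
Proof.
move=> As; have finA : finite_set A by apply: sub_finite_set As (finite_seq s).
split=> //; rewrite cardfE.
apply: leq_trans (size_undup s); rewrite -cardfE.
apply: uniq_leq_size; first exact: fset_uniq.
by move=> t; rewrite mem_undup in_fset_set // inE => /As.
Qed.

Lemma card_fset_set_ge (T : choiceType) (A : set T) (s : seq T) :
  finite_set A -> uniq s -> [set` s] `<=` A -> (size s <= #|` fset_set A|)%N.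
Proof.
move=> finA us sA; apply: uniq_leq_size => // t ts.
by rewrite in_fset_set // inE; apply: sA.
Qed.

Variables (ell g : R) (H n0 : nat).
Hypotheses (Hl : 1 <= H%:R * ell) (Hg : 1 <= H%:R * g) (H_gt0 : (0 < H)%N).
Hypothesis gap : forall n m, (n0 <= n)%N -> (0 < m)%N ->
  expR (n%:R * ell / 2) < `|expR (n%:R * ell) - expR (m%:R * g)|.

Let H1 : 1 <= H%:R :> R. Proof. by rewrite (ler_nat _ 1). Qed.
Let l_gt0 : 0 < ell. Proof. by rewrite -(pmulr_rgt0 _ (lt_le_trans ltr01 H1)) (lt_le_trans
    ltr01). Qed.
Let g_gt0 : 0 < g. Proof. by rewrite -(pmulr_rgt0 _ (lt_le_trans ltr01 H1)) (lt_le_trans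
    ltr01). Qed.
Let e_ge2 : 2 <= expR 1 :> R. Proof. by have := expR_ge1Dx (1 : R); lra. Qed.

(** As e >= 2, q < p - 1 would give e^p <= e^q + e^u < 2 e^(p-1) <= e^p. *)
Lemma expR_close (u p q : R) : u + 1 < p -> `|expR p - expR q| <= expR u -> p - 1 <= q.
Proof.
move=> up; rewrite ler_distl => /andP[_ h]; rewrite leNgt; apply/negP => pq.
have h1 : expR u < expR (p - 1) by rewrite ltr_expR; lra.
have h2 : expR q < expR (p - 1) by rewrite ltr_expR.
have h3 : expR p = expR (p - 1) * expR 1 by rewrite -expRD subrK.
have := ler_wpM2l (expR_ge0 (p - 1)) e_ge2; lra.
Qed.

Variables (A : set (nat * nat)) (u : R).
Hypothesis A_le : forall n m, A (n, m) ->
  [/\ (0 < n)%N, (0 < m)%N & `|expR (n%:R * ell) - expR (m%:R * g)| <= expR u].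
Hypothesis A_ge : forall n m, (0 < n)%N -> (0 < m)%N ->
  expR (n%:R * ell) + expR (m%:R * g) <= expR u -> A (n, m).
Hypothesis u_ge : (n0 + H + 4)%:R <= u.

(** [expR_close] applies to each exponent above u + 1; an exponent not above it is smaller than the
    other one, which makes the remaining inequality trivial. *)
Lemma near_diagonal n m : A (n, m) -> u + 1 < n%:R * ell \/ u + 1 < m%:R * g ->
  n%:R * ell - 1 <= m%:R * g <= n%:R * ell + 1.
Proof.
move=> /A_le [n_gt0 m_gt0 close] h.
have close' : `|expR (m%:R * g) - expR (n%:R * ell)| <= expR u by rewrite distrC.
apply/andP; case: h => h.
  have h1 := expR_close h close; split=> //.
  have [hm|hm] := leP (m%:R * g) (u + 1); first by lra.
  by have := expR_close hm close'; lra.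
have h1 := expR_close h close'; split; last by lra.
have [hn|hn] := leP (n%:R * ell) (u + 1); first by lra.
exact: (expR_close hn close).
Qed.

(** The pairs are covered by a box, which gives the main term, and by a strip along the diagonal
    with O(u) rows of at most 2 H + 2 points each. *)
Lemma count_le : finite_set A /\
  (#|` fset_set A|)%:R <= u ^+ 2 / (ell * g) + (3 * H ^ 2 + (2 * H + 2) ^ 2)%:R * u.
Proof.
pose p := Num.truncn ((u + 1) / ell); pose q := Num.truncn ((u + 1) / g).
pose N := (Num.truncn (2 * u / ell) + n0).+1.
(* In row [n] the strip has length 2 / g <= 2 H. For a negative argument [Num.truncn] is 0, still a
   valid start. *)
pose start n := Num.truncn ((n%:R * ell - 1) / g).
pose s := [seq (n, m) | n <- iota 1 p, m <- iota 1 q] ++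
  [seq (n, start n + j)%N | n <- iota 0 N, j <- iota 0 (2 * H + 2)].
have h0 := H1; have u4 : n0%:R + H%:R + 4 <= u by move: u_ge; rewrite !natrD.
have u4' : 4 <= u by have : 0 <= n0%:R :> R by []; lra.
have u0 : 0 <= u by lra.
have [lV gV] : 1 / ell <= H%:R /\ 1 / g <= H%:R by rewrite !ler_pdivrMr.
have ul : 0 <= (u + 1) / ell by rewrite divr_ge0 ?addr_ge0 // ltW.
have ug : 0 <= (u + 1) / g by rewrite divr_ge0 ?addr_ge0 // ltW.
have As : A `<=` [set` s].
  move=> [n m] Anm; have [n_gt0 m_gt0 close] := A_le Anm; rewrite /= mem_cat.
  have [box|/negP nbox] := boolP ((n%:R * ell <= u + 1) && (m%:R * g <= u + 1)).
    apply/orP; left; case/andP: box => hn hm.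
    apply: allpairs_f; rewrite mem_iota add1n ltnS ?n_gt0 ?m_gt0 /=.
      by rewrite (truncn_ge_nat _ ul) ler_pdivlMr.
    by rewrite (truncn_ge_nat _ ug) ler_pdivlMr.
  have out : u + 1 < n%:R * ell \/ u + 1 < m%:R * g.
    have [h|h] := leP (n%:R * ell) (u + 1); last by left.
    have [h'|h'] := leP (m%:R * g) (u + 1); last by right.
    by case: nbox; rewrite h.
  have /andP[d1 d2] := near_diagonal Anm out.
  apply/orP; right.
  have start_le : (start n <= m)%N.
    by rewrite truncn_le_nat ltr_pdivrMr // -natr1 mulrDl mul1r; have := g_gt0; lra.
  have -> : m = (start n + (m - start n))%N by rewrite subnKC.
  apply: (@allpairs_f _ _ _ (fun n j => (n, start n + j)%N)); rewrite mem_iota add0n /=.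
    (* Rows up to [n0] are counted wholesale; beyond them the gap and the closeness give n ell / 2 <
       u. *)
    rewrite /N ltnS; have [|hn0] := leqP n n0; first by move=> h; rewrite (leq_trans h) ?leq_addl.
    apply: leq_trans (leq_addr _ _).
    rewrite truncn_ge_nat; last by rewrite divr_ge0 ?mulr_ge0 // ltW.
    rewrite ler_pdivlMr //.
    have := lt_le_trans (gap (ltnW hn0) m_gt0) close; rewrite ltr_expR ltr_pdivrMr // => h; lra.
  have := truncnS_gt ((n%:R * ell - 1) / g); rewrite -/(start n) ltr_pdivrMr // => hs.
  have hm : m%:R * g < (start n + (2 * H + 2))%:R * g.
    have -> : (start n + (2 * H + 2) = (start n).+1 + (2 * H + 1))%N.
      by rewrite addn2 addn1 !addnS addSn.
    rewrite natrD mulrDl natrD natrM.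
    have := Hg; have := g_gt0.
    lra.
  by rewrite ltr_pM2r // ltr_nat in hm; rewrite ltn_subLR.
have [finA leA] := card_fset_set_le As; split=> //.
have szs : size s = (p * q + N * (2 * H + 2))%N by rewrite size_cat !size_allpairs !size_iota.
apply: (@le_trans _ _ (size s)%:R); first by rewrite ler_nat.
have hp : p%:R <= (u + 1) / ell by rewrite truncn_le.
have hq : q%:R <= (u + 1) / g by rewrite truncn_le.
have hN : N%:R <= u * (2 * H%:R + 2).
  have : (Num.truncn (2 * u / ell))%:R <= 2 * u / ell by rewrite truncn_le divr_ge0 ?mulr_ge0
      // ltW.
  rewrite /N -[_.+1]addn1 !natrD.
  have : u * (1 / ell) <= u * H%:R by rewrite ler_wpM2l.
  have -> : 2 * u / ell = 2 * (u * (1 / ell)) by ring.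
  have := H1; lra.
have hpq : p%:R * q%:R <= (u + 1) / ell * ((u + 1) / g) by apply: ler_pM.
rewrite szs natrD !natrM natrD.
have hNk : N%:R * (2 * H%:R + 2) <= u * (2 * H%:R + 2) * (2 * H%:R + 2).
  by rewrite ler_wpM2r // addr_ge0 // mulr_ge0.
have expand : (u + 1) / ell * ((u + 1) / g) =
    u ^+ 2 / (ell * g) + (2 * u + 1) * (1 / ell * (1 / g)) by rewrite invfM; ring.
rewrite {}expand in hpq.
have hlg : (2 * u + 1) * (1 / ell * (1 / g)) <= 3 * u * (H%:R * H%:R).
  apply: ler_pM => //; [lra|by rewrite mulr_ge0 // divr_ge0 // ltW|lra|].
  by apply: ler_pM => //; rewrite divr_ge0 // ltW.
rewrite !(natrD, natrX, natrM); lra.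
Qed.

(** Every pair with both exponents at most u - 1 is counted, since 2 e^(u-1) <= e^u. Truncation
    loses less than one in each direction, which costs a term linear in [u]. *)
Lemma count_ge : finite_set A ->
  u ^+ 2 / (ell * g) - (3 * H ^ 2 + (2 * H + 2) ^ 2)%:R * u <= (#|` fset_set A|)%:R.
Proof.
move=> finA.
pose p := Num.truncn ((u - 1) / ell); pose q := Num.truncn ((u - 1) / g).
pose s := [seq (n, m) | n <- iota 1 p, m <- iota 1 q].
have h0 := H1; have u4 : n0%:R + H%:R + 4 <= u by move: u_ge; rewrite !natrD.
have u1 : 1 <= u - 1 by have : 0 <= n0%:R :> R by []; have := H1; lra.
have [lV gV] : 1 / ell <= H%:R /\ 1 / g <= H%:R by rewrite !ler_pdivrMr.
have u1' : 0 <= u - 1 by lra.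
have ul : 0 <= (u - 1) / ell by rewrite divr_ge0 // ltW.
have ug : 0 <= (u - 1) / g by rewrite divr_ge0 // ltW.
have us : uniq s by apply: allpairs_uniq => [||[? ?] [? ?]]; rewrite ?iota_uniq.
have sA : [set` s] `<=` A.
  move=> nm /= /allpairsP[[n m] /= [hn hm ->]].
  move: hn hm; rewrite !mem_iota !add1n !ltnS => /andP[n_gt0 hn] /andP[m_gt0 hm].
  apply: A_ge => //.
  rewrite (truncn_ge_nat _ ul) ler_pdivlMr // in hn.
  rewrite (truncn_ge_nat _ ug) ler_pdivlMr // in hm.
  have h1 : expR (n%:R * ell) <= expR (u - 1) by rewrite ler_expR.
  have h2 : expR (m%:R * g) <= expR (u - 1) by rewrite ler_expR.
  have h3 : expR u = expR (u - 1) * expR 1 by rewrite -expRD subrK.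
  have := ler_wpM2l (expR_ge0 (u - 1)) e_ge2; lra.
have := card_fset_set_ge finA us sA; rewrite size_allpairs !size_iota => hA.
apply: (@le_trans _ _ (p * q)%:R); last by rewrite ler_nat.
have hp := truncnS_gt ((u - 1) / ell); have hq := truncnS_gt ((u - 1) / g).
rewrite -/p -natr1 in hp; rewrite -/q -natr1 in hq.
have x0 : 0 < 1 / ell by rewrite divr_gt0.
have y0 : 0 < 1 / g by rewrite divr_gt0.
have hl : (u - 1) / ell = (u - 1) * (1 / ell) by ring.
have hg' : (u - 1) / g = (u - 1) * (1 / g) by ring.
rewrite hl in hp; rewrite hg' in hq.
have pu : p%:R <= u * H%:R.
  have : p%:R <= (u - 1) / ell by rewrite truncn_le.
  rewrite hl => h; apply: le_trans h _; apply: ler_pM => //; [exact: ltW|lra].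
have qu : q%:R <= u * H%:R.
  have : q%:R <= (u - 1) / g by rewrite truncn_le.
  rewrite hg' => h; apply: le_trans h _; apply: ler_pM => //; [exact: ltW|lra].
have -> : u ^+ 2 / (ell * g) = u ^+ 2 * (1 / ell * (1 / g)) by rewrite invfM; ring.
move: (1 / ell) (1 / g) x0 y0 hp hq lV gV {hl hg'} => x y x0 y0 hp hq lV gV.
rewrite !(natrD, natrX, natrM).
have h1 : (u - 1) * x * ((u - 1) * y) <= (p%:R + 1) * (q%:R + 1).
  by apply: ler_pM; rewrite ?mulr_ge0 //; apply: ltW.
have u0 : 0 <= u by lra.
have h2 : u * (x * y) <= u * (H%:R * H%:R).
  by rewrite ler_wpM2l //; apply: ler_pM => //; apply: ltW.
have h3 : x * y <= H%:R * H%:R by apply: ler_pM => //; apply: ltW.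
have h4 : H%:R * H%:R <= u * (H%:R * H%:R) by rewrite ler_peMl ?mulr_ge0 //; lra.
have h5 : u <= u * H%:R by rewrite ler_peMr //; lra.
have -> : u ^+ 2 * (x * y) = (u - 1) * x * ((u - 1) * y) + 2 * (u * (x * y)) - x * y by ring.
have h6 : 0 <= x * y by rewrite mulr_ge0 // ltW.
lra.
Qed.

End Counting.

(** * Effective constants for algebraic numbers *)

Section Assembly.
Variable R : realType.
Local Notation toC := (real_complex R).

Lemma normcX (z : R[i]) n : normc (z ^+ n) = normc z ^+ n.
Proof. by elim: n => [|n IHn]; rewrite ?normc1 // !exprS normcM IHn. Qed.

Lemma normc_expC (z : R[i]) : normc (expC z) = expR (complex.Re z).
Proof.
rewrite /normc /expC !exprMn -mulrDr cos2Dsin2 mulr1.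
by rewrite sqrtr_sqr ger0_norm ?expR_ge0.
Qed.

Lemma normc_dist (z w : R[i]) : `|normc z - normc w| <= normc (z - w).
Proof.
rewrite ler_norml; have := le_normcD (z - w) w; have := le_normcD (w - z) z.
rewrite !subrK -[w - z]opprB normcN; lra.
Qed.

Lemma normc_sqr (z : R[i]) : toC (normc z ^+ 2) = z * conjc z.
Proof.
case: z => x y; rewrite /= sqr_sqrtr ?addr_ge0 ?sqr_ge0 //.
apply/eqP; rewrite eq_complex /=; apply/andP; split; apply/eqP; ring.
Qed.

Lemma root_conjc (p : {poly int}) (z : R[i]) :
  root (map_poly intr p) z -> root (map_poly intr p) (conjc z).
Proof.
move=> pz; rewrite -complex_root_conj -map_poly_comp.
suff -> : map_poly (conjc \o intr) p = map_poly intr p :> {poly R[i]} by [].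
by apply: eq_map_poly => c /=; rewrite rmorph_int.
Qed.

(* For polynomials of size and coefficient norm at most [T], [height_bound0] bounds the operators
   representing the scaled numbers, and [height_bound] also [1 / ln |alpha|] and [1 / Re gamma]. *)
Definition height_bound0 (T : nat) := (2 * T ^ 2)%N.
(** Four tensor factors of dimension at most [T]: the powers of alpha, of gamma and of their
    conjugates. *)
Definition dim_bound (T : nat) := (T ^ 4)%N.
Definition height_bound (T : nat) := (2 * height_bound0 T ^ 2 * (2 * height_bound0 T) ^
    dim_bound T)%N.
Definition gap_start (T : nat) := ((rho_min (dim_bound T) (height_bound T)).+1 ^ 2)%N.
Definition error_constant (T : nat) := (3 * height_bound T ^ 2 + (2 * height_bound T + 2) ^ 2)%N.
(** A power of 4 because e <= 4: past it ln x is at least the exponent, as the counting lemmas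
    ask. *)
Definition error_threshold (T : nat) := (4 ^ (gap_start T + height_bound T + 4))%N.


Lemma lead_coef_norm (p : {poly int}) : p != 0 -> (0 < absz (lead_coef p) <= int_poly_norm p)%N.
Proof.
move=> p0; rewrite absz_gt0 lead_coef_eq0 p0 /=.
have sp : (0 < size p)%N by rewrite size_poly_gt0.
rewrite /int_poly_norm lead_coefE -(prednK sp) big_ord_recr /=; exact: leq_addl.
Qed.

Lemma size_root_gt1 (p : {poly int}) (z : R[i]) :
  p != 0 -> root (map_poly intr p) z -> exists n, size p = n.+2.
Proof.
move=> p0 pz; have sp : (0 < size p)%N by rewrite size_poly_gt0.
have sp1 : size p != 1%N.
  apply/negP => /size_poly1P [c c0 pE]; move: pz.
  by rewrite pE map_polyC rootC intr_eq0 (negbTE c0).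
by exists (size p).-2; lia.
Qed.

(** |alpha|^2 is the product and 2 Re gamma the sum of a conjugate pair; all four numbers act on one
    tensor product of vectors of powers. *)
Lemma conj_pair_op (n1 n2 T : nat) (p1 p2 : {poly int}) (alpha gamma : R[i]) :
  size p1 = n1.+2 -> size p2 = n2.+2 -> p1 != 0 -> p2 != 0 ->
  (int_poly_norm p1 <= T)%N -> (int_poly_norm p2 <= T)%N ->
  root (map_poly intr p1) alpha -> root (map_poly intr p2) gamma ->
  exists v : ('I_n1.+1 * 'I_n1.+1) * ('I_n2.+1 * 'I_n2.+1) -> R[i],
  [/\ exists i, v i != 0,
    int_op v (T ^ 2) (toC ((absz (lead_coef p1) ^ 2)%:R * normc alpha ^+ 2)) &
    int_op v (T + T) (toC ((absz (lead_coef p2))%:R * (2 * complex.Re gamma)))].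
Proof.
move=> sz1 sz2 p10 p20 N1 N2 r1 r2.
pose v1 (i : 'I_n1.+1) := alpha ^+ i; pose v1' (i : 'I_n1.+1) := conjc alpha ^+ i.
pose v2 (i : 'I_n2.+1) := gamma ^+ i; pose v2' (i : 'I_n2.+1) := conjc gamma ^+ i.
pose w1 (i : 'I_n1.+1 * 'I_n1.+1) := v1 i.1 * v1' i.2.
pose w2 (i : 'I_n2.+1 * 'I_n2.+1) := v2 i.1 * v2' i.2.
exists (fun i => w1 i.1 * w2 i.2); split.
- exists ((ord0, ord0), (ord0, ord0)).
  by rewrite /w1 /w2 /v1 /v1' /v2 /v2' /= !expr0 !mulr1 oner_neq0.
- have op : int_op v1 T ((lead_coef p1)%:~R * alpha) := int_op_le N1 (int_op_root sz1 r1).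
  have op' : int_op v1' T ((lead_coef p1)%:~R * conjc alpha).
    exact: int_op_le N1 (int_op_root sz1 (root_conjc r1)).
  have := int_op_tensorl w2 (int_opM (int_op_tensorl v1' op) (int_op_tensorr v1 op')).
  rewrite mulnn mulrACA -normc_sqr; congr int_op.
  rewrite [RHS]rmorphM; congr (_ * _).
  rewrite rmorph_nat pmulrn -rmorphM /=; congr (_%:~R); lia.
- have op : int_op v2 T ((lead_coef p2)%:~R * gamma) := int_op_le N2 (int_op_root sz2 r2).
  have op' : int_op v2' T ((lead_coef p2)%:~R * conjc gamma).
    exact: int_op_le N2 (int_op_root sz2 (root_conjc r2)).
  have := int_opD (int_op_tensorl v2' op) (int_op_tensorr v2 op').
  (* The sign of the leading coefficient is corrected by a unit, as the scaling factors are natural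
     numbers. *)
  have [e [eE e1]] : exists e : int, e * lead_coef p2 = absz (lead_coef p2) /\ (absz e <= 1)%N.
    by case: (lead_coef p2) => k; [exists 1|exists (-1)]; split => //; lia.
  move=> /(int_opM (int_op_int _ e)) /(int_op_tensorr w1).
  rewrite -mulrDr addcJ mulrA -rmorphM /= eE => h.
  have -> : toC ((absz (lead_coef p2))%:R * (2 * complex.Re gamma)) =
    (absz (lead_coef p2) : int)%:~R * (2%:R * toC (complex.Re gamma)).
    by rewrite !rmorphM /= !rmorph_nat.
  by apply: int_op_le h; rewrite -[X in (_ <= X)%N]mul1n leq_mul2r e1 orbT.
Qed.

End Assembly.

Section Assembly2.
Variable R : realType.
Local Notation toC := (real_complex R).

Lemma int_op_norm_real (I : finType) (v : I -> R[i]) B (x : R) :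
  (exists i, v i != 0) -> int_op v B (toC x) -> `|x| <= B%:R.
Proof.
move=> v0 opx; have := int_op_norm v0 opx.
by rewrite -lecR normc_def /= expr0n addr0 sqrtr_sqr rmorph_nat.
Qed.

(** Liouville's inequality for c1 (e^(2 ell) - 1) and 2 c2 g keeps [ell] and [g] away from 0 in
    terms of [T]; their upper bounds come from the matrix norms. Then [power_gap] applies. *)
Lemma algebraic_power_gap (T : nat) (p1 p2 : {poly int}) (alpha gamma : R[i]) :
  p1 != 0 -> p2 != 0 -> (size p1 <= T)%N -> (size p2 <= T)%N ->
  (int_poly_norm p1 <= T)%N -> (int_poly_norm p2 <= T)%N ->
  root (map_poly intr p1) alpha -> root (map_poly intr p2) gamma ->
  1 < normc alpha -> 0 < complex.Re gamma ->
  let ell := ln (normc alpha) in let g := complex.Re gamma in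
  [/\ 1 <= (height_bound T)%:R * ell, 1 <= (height_bound T)%:R * g, (0 < height_bound T)%N &
    forall n m, (gap_start T <= n)%N -> (0 < m)%N ->
      expR (n%:R * ell / 2) < `|expR (n%:R * ell) - expR (m%:R * g)|].
Proof.
move=> p10 p20 s1 s2 N1 N2 r1 r2 alpha1 gamma0 ell g.
have [n1 sz1] := size_root_gt1 p10 r1; have [n2 sz2] := size_root_gt1 p20 r2.
have [v [v0 op1 op2]] := conj_pair_op sz1 sz2 p10 p20 N1 N2 r1 r2.
have /andP[l1 l1N] := lead_coef_norm p10; have /andP[l2 l2N] := lead_coef_norm p20.
set c1 := (absz (lead_coef p1) ^ 2)%N in op1.
set c2 := absz (lead_coef p2) in op2 l2 l2N.
have T0 : (0 < T)%N := leq_trans l1 (leq_trans l1N N1).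
have l0 : 0 < ell by rewrite ln_gt0.
have Id : (#|{: ('I_n1.+1 * 'I_n1.+1) * ('I_n2.+1 * 'I_n2.+1)}| <= dim_bound T)%N.
  have n1T : (n1.+1 <= T)%N by apply: leq_trans s1; rewrite sz1.
  have n2T : (n2.+1 <= T)%N by apply: leq_trans s2; rewrite sz2.
  by rewrite !card_prod !card_ord /dim_bound (expnD T 2 2) -mulnn !leq_mul.
set H' := height_bound0 T; have H'E : H' = (2 * T ^ 2)%N by [].
have c1_gt0 : (0 < c1)%N by rewrite expn_gt0 l1.
have c1H : (c1 <= T ^ 2)%N by rewrite leq_exp2r // (leq_trans l1N).
have c1H' : (c1 <= H')%N by rewrite H'E; lia.
have c2H' : (c2 <= H')%N by apply: leq_trans (leq_trans l2N N2) _; rewrite H'E; nia.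
have H'0 : (0 < H')%N := leq_trans c1_gt0 c1H'.
have eE : normc alpha ^+ 2 = expR (2 * ell).
  by rewrite expRM_natl lnK // posrE (lt_trans ltr01).
rewrite eE in op1.
have {}op1 : int_op v H' (toC (c1%:R * expR (2 * ell))).
  by apply: int_op_le op1; rewrite H'E; lia.
have {}op2 : int_op v H' (toC (c2%:R * (2 * g))).
  by apply: int_op_le op2; rewrite H'E; nia.
have B1 := int_op_norm_real v0 op1; have B2 := int_op_norm_real v0 op2.
have c1r : 1 <= c1%:R :> R by rewrite (ler_nat _ 1).
have c2r : 1 <= c2%:R :> R by rewrite (ler_nat _ 1).
have E0 := expR_gt0 (2 * ell).
rewrite gtr0_norm ?mulr_gt0 ?ltr0n // in B1.
rewrite gtr0_norm ?mulr_gt0 ?ltr0n // in B2.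
pose D := (2 * H')%:R ^+ dim_bound T : R.
have H2r : 1 <= (2 * H')%:R :> R by rewrite (ler_nat _ 1) muln_gt0.
have D0 : 0 < D by rewrite exprn_gt0 // (lt_le_trans ltr01).
have HE : (height_bound T)%:R = 2 * H'%:R * H'%:R * D :> R.
  by rewrite /height_bound -/H' /D -natrX -!natrM -mulnn !mulnA.
have H'r : 1 <= H'%:R :> R by rewrite (ler_nat _ 1).
have D1 : 1 <= D by rewrite exprn_ege1.
have dim B : (0 < B)%N -> (B <= 2 * H')%N -> B%:R ^+ #|{: ('I_n1.+1 * 'I_n1.+1) * ('I_n2.+1 *
    'I_n2.+1)}| <= D.
  move=> b0 B2H; apply: (@le_trans _ _ ((2 * H')%:R ^+ #|{: ('I_n1.+1 * 'I_n1.+1) * ('I_n2.+1 *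
      'I_n2.+1)}|)).
    by rewrite lerXn2r ?nnegrE // ler_nat.
  by rewrite ler_weXn2l.
(* The logarithm [ell] is reached through the algebraic number e^(2 ell), by e^(2 ell) - 1 <= 2 ell
   e^(2 ell). *)
have Hl : 1 <= 2 * H'%:R * ell * D.
  have op : int_op v (2 * H') (toC (c1%:R * expR (2 * ell) - c1%:R)).
    have opc : int_op v c1 (- toC c1%:R).
      have := int_op_int v (- (c1%:Z)).
      by rewrite rmorphN /= -pmulrn abszN absz_nat rmorph_nat.
    rewrite rmorphB; have := int_opD op1 opc; apply: int_op_le.
    by rewrite mul2n -addnn leq_add2l.
  have e1 : 1 < expR (2 * ell) by rewrite expR_gt1 mulr_gt0.
  have x0 : 0 < c1%:R * expR (2 * ell) - c1%:R.
    by rewrite subr_gt0 ltr_pMr // (lt_le_trans ltr01).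
  have := int_op_liouville_real v0 op (lt0r_neq0 x0).
  rewrite gtr0_norm // => h; apply: le_trans h _.
  apply: (ler_pM (ltW x0) (exprn_ge0 _ (ler0n _ _))); last first.
    by apply: (dim (2 * H')%N); rewrite ?leqnn // muln_gt0.
  have := ler_wpM2l (ltW E0) (expR_ge1Dx (- (2 * ell))).
  rewrite -expRD subrr expR0 mulrDr mulr1 mulrN => h1.
  have h2 : c1%:R * (expR (2 * ell) - expR (2 * ell) * (2 * ell)) <= c1%:R * 1.
    by rewrite ler_wpM2l.
  have h3 : c1%:R * expR (2 * ell) * (2 * ell) <= H'%:R * (2 * ell).
    by rewrite ler_wpM2r // mulr_ge0 // ltW.
  lra.
have Hg : 1 <= 2 * H'%:R * g * D.
  have x0 : 0 < c2%:R * (2 * g) by rewrite mulr_gt0 ?mulr_gt0 // ltr0n.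
  have := int_op_liouville_real v0 op2 (lt0r_neq0 x0).
  rewrite gtr0_norm // => h; apply: le_trans h _.
  apply: (ler_pM (ltW x0) (exprn_ge0 _ (ler0n _ _))); last first.
    by apply: (dim H'); rewrite // leq_pmull.
  have -> : 2 * H'%:R * g = H'%:R * (2 * g) by ring.
  by rewrite ler_wpM2r ?ler_nat // mulr_ge0 // ltW.
have leH : H'%:R <= (height_bound T)%:R :> R.
  have hHD : 1 <= H'%:R * D by apply: mulr_ege1.
  have -> : (height_bound T)%:R = H'%:R * (2 * (H'%:R * D)) :> R by rewrite HE; ring.
  by rewrite ler_peMr //; lra.
have leHn : (H' <= height_bound T)%N by rewrite -(ler_nat R).
have lH : ell <= (height_bound T)%:R.
  apply: le_trans leH; apply: le_trans B1.
  have h1 := expR_ge1Dx (2 * ell).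
  have h2 : expR (2 * ell) <= c1%:R * expR (2 * ell) by rewrite ler_peMl // ltW.
  lra.
have gH : g <= (height_bound T)%:R.
  apply: le_trans leH; apply: le_trans B2.
  have h2 : 2 * g <= c2%:R * (2 * g) by rewrite ler_peMl // mulr_ge0 // ltW.
  have := gamma0; rewrite -/g; lra.
have Hl' : 1 <= (height_bound T)%:R * ell.
  have -> : (height_bound T)%:R * ell = H'%:R * (2 * H'%:R * ell * D) by rewrite HE; ring.
  exact: mulr_ege1.
have Hg' : 1 <= (height_bound T)%:R * g.
  have -> : (height_bound T)%:R * g = H'%:R * (2 * H'%:R * g * D) by rewrite HE; ring.
  exact: mulr_ege1.
split=> //; first exact: leq_trans leHn.
move=> n m nN m0; apply: (power_gap v0 Id _ _ (int_op_le leHn op1) (int_op_le leHn op2)) => //.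
  by rewrite c1_gt0 (leq_trans c1H').
by rewrite l2 (leq_trans c2H').
Qed.

End Assembly2.

(** * Recursiveness of the constants *)

Lemma recursive_fact k (f : k.-tuple nat -> nat) :
  recursive f -> recursive (fun t => (f t)`!).
Proof.
move=> recf.
have rec1 : recursive (fun _ : 0.-tuple nat => 1%N) by apply: recursive_const.
have recS : recursive (fun t : 2.-tuple nat => (thead t + 1)%N).
  by apply: recursive_add; [apply: rec_proj|apply: recursive_const].
have recM : recursive (fun t : 2.-tuple nat => muln (addn (thead t) 1) (tnth t 1)).
  by apply: recursive_mul recS _; apply: rec_proj.
have fact1 : recursive (fun t : 1.-tuple nat => (thead t)`!).
  apply: eq_recursive (rec_prim rec1 recM) => t.
  elim: (thead t) => //= n IHn; rewrite factS -IHn addn1.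
  by rewrite /thead !(tnth_nth 0%N).
by apply: eq_recursive (rec_comp fact1 (fun=> recf)) => t; rewrite /thead tnth_mktuple.
Qed.

Ltac recursive_tac := repeat first
  [ assumption | apply: recursive_const | apply: recursive_fact
  | apply: recursive_exp | apply: recursive_mul | apply: recursive_add ].

Lemma recursive_minrho k (d H : k.-tuple nat -> nat) :
  recursive d -> recursive H -> recursive (fun t => rho_min (d t) (H t)).
Proof.
move=> recd recH.
have recK : recursive (fun t => approx_degree (d t)) by rewrite /approx_degree; recursive_tac.
have recS (f : k.-tuple nat -> nat) : recursive f -> recursive (fun t => (f t).+1).
  move=> recf; apply: (@eq_recursive _ (fun t => f t + 1)%N); first by move=> t; rewrite addn1.
  by recursive_tac.
have recK1 := recS _ recK; have recK2 := recS _ recK1; have recd1 := recS _ recd.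
have recL : recursive (fun t => approx_scale (d t) (H t)) by rewrite /approx_scale; recursive_tac.
have recQ : recursive (fun t => coef_base (d t) (H t)) by rewrite /coef_base; recursive_tac.
have recE : recursive (fun t => exp_base (H t)) by rewrite /exp_base; recursive_tac.
have recW : recursive (fun t => cstW (d t) (H t)) by rewrite /cstW; recursive_tac.
have recU : recursive (fun t => cstU (d t) (H t)) by rewrite /cstU; recursive_tac.
have recV : recursive (fun t => cstV (d t) (H t)) by rewrite /cstV; recursive_tac.
by rewrite /rho_min; recursive_tac.
Qed.

Lemma recursive_par k (T : k.-tuple nat -> nat) : recursive T ->
  recursive (fun t => error_constant (T t)) /\ recursive (fun t => error_threshold (T t)).
Proof.
move=> recT.
have recH' : recursive (fun t => height_bound0 (T t)) by rewrite /height_bound0; recursive_tac.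
have recD : recursive (fun t => dim_bound (T t)) by rewrite /dim_bound; recursive_tac.
have recH : recursive (fun t => height_bound (T t)) by rewrite /height_bound; recursive_tac.
have recN : recursive (fun t => gap_start (T t)).
  have recr := recursive_minrho recD recH.
  apply: (@eq_recursive _ (fun t => (rho_min (dim_bound (T t)) (height_bound (T t)) + 1) ^ 2)%N).
    by move=> t; rewrite /gap_start addn1.
  by recursive_tac.
by split; rewrite /error_constant /error_threshold; recursive_tac.
Qed.

(** * The asymptotic count for algebraic numbers *)

Section Final.
Variable R : realType.

(** The triangle inequality compares the distance of the two powers with their moduli from both
    sides, and the counting lemmas apply with u = ln x. *)
Lemma close_count_bound (T : nat) (p1 p2 : {poly int}) (alpha gamma : R[i]) :
  p1 != 0 -> p2 != 0 -> (size p1 <= T)%N -> (size p2 <= T)%N ->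
  (int_poly_norm p1 <= T)%N -> (int_poly_norm p2 <= T)%N ->
  root (map_poly intr p1) alpha -> root (map_poly intr p2) gamma ->
  1 < normc alpha -> 0 < complex.Re gamma ->
  (forall x : R, finite_set (close_pairs alpha gamma x)) /\
  forall x : R, (error_threshold T)%:R <= x ->
    `|(close_count alpha gamma x)%:R - ln x ^+ 2 / (ln (normc alpha) * complex.Re gamma)|
      <= (error_constant T)%:R * (ln x * ln (ln x)).
Proof.
move=> p10 p20 s1 s2 N1 N2 r1 r2 alpha1 gamma0.
have [Hl Hg H0 gap] := algebraic_power_gap p10 p20 s1 s2 N1 N2 r1 r2 alpha1 gamma0.
set ell := ln (normc alpha) in Hl gap *; set g := complex.Re gamma in Hg gap *.
have alphaE n : normc (alpha ^+ n) = expR (n%:R * ell).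
  by rewrite normcX expRM_natl lnK // posrE (lt_trans ltr01).
have gammaE m : normc (expC gamma ^+ m) = expR (m%:R * g).
  by rewrite normcX normc_expC expRM_natl.
have threshold_gt0 : 0 < (error_threshold T)%:R :> R by rewrite ltr0n expn_gt0.
have u_ge (x : R) : (error_threshold T)%:R <= x -> (gap_start T + height_bound T + 4)%:R <= ln x.
  move=> xX; have x0 : 0 < x := lt_le_trans threshold_gt0 xX.
  by rewrite -ler_expR lnK ?posrE // (le_trans (expR_le_expn (lexx _))).
have A_le (x : R) : (error_threshold T)%:R <= x -> forall n m, close_pairs alpha gamma x (n, m) ->
    [/\ (0 < n)%N, (0 < m)%N & `|expR (n%:R * ell) - expR (m%:R * g)| <= expR (ln x)].
  move=> xX n m [/= n0 m0 close]; split=> //.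
  rewrite lnK ?posrE ?(lt_le_trans threshold_gt0) // -alphaE -gammaE.
  exact: le_trans (normc_dist _ _) close.
have A_ge (x : R) : (error_threshold T)%:R <= x -> forall n m, (0 < n)%N -> (0 < m)%N ->
    expR (n%:R * ell) + expR (m%:R * g) <= expR (ln x) -> close_pairs alpha gamma x (n, m).
  move=> xX n m n0 m0; rewrite lnK ?posrE ?(lt_le_trans threshold_gt0) // -alphaE -gammaE => h.
  split=> //=; apply: le_trans h; apply: le_trans (le_normcD _ _) _.
  by rewrite normcN.
split=> x.
  (* Finiteness for small [x] is inherited from beyond the threshold, as the sets increase with
     [x]. *)
  pose y := Num.max x (error_threshold T)%:R.
  have yX : (error_threshold T)%:R <= y by rewrite le_max lexx orbT.
  have [finy _] := count_le Hl Hg H0 gap (A_le y yX) (u_ge y yX).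
  apply: sub_finite_set finy => -[n m] [/= n0 m0 close]; split=> //=.
  by apply: le_trans close _; rewrite le_max lexx.
move=> xX; have ux := u_ge x xX.
have [finx up] := count_le Hl Hg H0 gap (A_le x xX) ux.
have low := count_ge Hl Hg H0 (A_ge x xX) ux finx.
have u4 : 4 <= ln x by apply: le_trans ux; rewrite natrD lerDr.
(* From ln x >= 4 >= e; this passes from an error bound in ln x to the stated one. *)
have lnln : 1 <= ln (ln x).
  rewrite -ler_expR lnK ?posrE; last by lra.
  exact: le_trans (expR1_le4 R) u4.
rewrite /close_count; set N := #|` _|%fset in up low *.
apply: (@le_trans _ _ ((error_constant T)%:R * ln x)).
  rewrite -/(error_constant T) in up low.
  by rewrite ler_norml; apply/andP; split; lra.
by rewrite ler_wpM2l // ler_peMr //; lra.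
Qed.

Lemma algebraic_int_poly (z : R[i]) : algebraicOver (ratr : rat -> R[i]) z ->
  exists2 p : {poly int}, p != 0 & root (map_poly intr p) z.
Proof.
move=> [p p0 pz]; have [q [a a0 pE]] := rat_poly_scale p.
exists q; first by apply: contraNneq p0 => q0; rewrite pE q0 map_poly0 scaler0.
move: pz; rewrite pE map_polyZ rootZ ?fmorph_eq0 ?invr_eq0 ?intr_eq0 //.
rewrite -map_poly_comp; congr (is_true (root _ z)); apply: eq_map_poly => c /=.
by rewrite ratr_int.
Qed.

Lemma describes_root (d : alg_descr) (z : R[i]) :
  describes d z -> d.1.1.1 != 0 /\ root (map_poly intr d.1.1.1) z.
Proof.
case: d => [[[p a] b] r] [p0 DZ]; split=> //.
have : [set z] z by [].
by rewrite -DZ => -[].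
Qed.

End Final.

Theorem theorem2 (R : realType) :
  exists C X : 2.-tuple nat -> nat,
  [/\ recursive C, recursive X &
   forall alpha gamma : R[i],
     algebraicOver (ratr : rat -> R[i]) alpha ->
     algebraicOver (ratr : rat -> R[i]) gamma ->
     1 < normc alpha ->
     0 < complex.Re gamma ->
     let E (x : R) : R := (close_count alpha gamma x)%:R
                  - ln x ^+ 2 / (ln (normc alpha) * complex.Re gamma) in
     [/\ forall x : R, finite_set (close_pairs alpha gamma x),
         exists K : R, \forall x \near +oo, `|E x| <= K * (ln x * ln (ln x)) &
         forall a c : alg_descr, describes a alpha -> describes c gamma ->
         let d := [tuple alg_code a; alg_code c] in
         forall x : R, (X d)%:R <= x ->
           `|E x| <= (C d)%:R * (ln x * ln (ln x))]].
Proof.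
(* A square, because [alg_code_poly] bounds the coefficient norm by the square of the code. *)
pose T (t : 2.-tuple nat) := ((thead t + tnth t (Ordinal (isT : 1 < 2)) + 1) ^ 2)%N.
have recT : recursive T.
  rewrite /T; apply: recursive_exp; last exact: recursive_const.
  apply: recursive_add; last exact: recursive_const.
  by apply: recursive_add; apply: rec_proj.
have [recC recX] := recursive_par recT.
exists (fun t => error_constant (T t)), (fun t => error_threshold (T t)); split=> // alpha
    gamma alg_a alg_g a1 g0 E.
have [p1 p10 r1] := algebraic_int_poly alg_a; have [p2 p20 r2] := algebraic_int_poly alg_g.
(* For the qualitative statement the polynomials come from algebraicity alone, without a
   description, and [T0] replaces the bound by codes. *)
pose T0 := (size p1 + size p2 + int_poly_norm p1 + int_poly_norm p2)%N.
have [fin bound] : _ /\ _ := close_count_bound (T := T0) p10 p20 ltac:(lia) ltac:(lia)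
    ltac:(lia) ltac:(lia) r1 r2 a1 g0.
split=> //.
  exists (error_constant T0)%:R; exists (error_threshold T0)%:R; split; first exact: num_real.
  by move=> x /ltW; apply: bound.
move=> a c da dc d x xX.
have [pa0 ra] := describes_root da; have [pc0 rc] := describes_root dc.
have [sa na] := alg_code_poly a; have [sc nc] := alg_code_poly c.
have leT n : (n <= alg_code a + alg_code c)%N -> (n <= T d)%N /\ (n ^ 2 <= T d)%N.
  move=> /leq_trans/(_ (leq_addr 1 _)) le_n; split; last exact: leq_exp2rW.
  exact: leq_trans le_n (leq_self_exp _ (isT : 0 < 2)%N).
have [[sa' na'] [sc' nc']] := (leT _ (leq_addr _ _), leT _ (leq_addl _ _)).
have [_ bd] := close_count_bound pa0 pc0 (leq_trans sa sa') (leq_trans sc sc')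
  (leq_trans na na') (leq_trans nc nc') ra rc a1 g0.
exact: bd.
Qed.
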